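(* Let $h$ be a potential on a recurrent rooted network $(G,c,o)$, and let $\{Y_n\}_{n\ge0}$ be the $h$-process with initial distribution $\mu_h(v)=c_{ov}h(v)$ for all $v\sim o$. Then almost surely the functions $\mathsf{g}_o(\cdot,Y_n)$ converge pointwise on $V$, as $n\to\infty$, to a random potential $H$ on $(G,c,o)$, $$\mathsf{g}_o(\cdot,Y_n)\longrightarrow H(\cdot),$$ and $\mathbb{E}H(x)=h(x)$ for every $x\in V$. If $h$ is an extremal potential, then $H=h$ almost surely.
   Context: A network $(G,c)$ is an infinite, connected, locally finite graph $G=(V,E)$ with positive edge weights (conductances) $c_{xy}=c_{yx}$, $xy\in E$; put $c_x=\sum_{z\sim x}c_{xz}$. The network random walk $\{X_n\}$ is the Markov chain on $V$ with transition probabilities $p(x,y)=c_{xy}/c_x$ for $x\sim y$; $\mathbb{P}_x$ is its law started at $x$. The network is recurrent if this walk is recurrent. A rooted network $(G,c,o)$ is a network with a distinguished vertex $o\in V$. The Laplacian of $f:V\to\mathbb{R}$ is $\Delta f(v)=\sum_{x\sim v}c_{vx}(f(x)-f(v))$. A potential on $(G,c,o)$ is a function $h:V\to[0,\infty)$ with $h(o)=0$, $\Delta h(o)=1$ and $\Delta h(v)=0$ for every $v\ne o$. A potential is extremal if it cannot be represented as a non-trivial convex combination of potentials on $(G,c,o)$. The Green density of the walk killed at $o$ is $\mathsf{g}_o(x,y)=\frac1{c_y}\sum_{n\ge0}\mathbb{P}_x(X_n=y,\ \tau_o>n)$, where $\tau_o=\min\{n\ge0:X_n=o\}$. For a potential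 $h$, the $h$-process is the Markov chain on $S_h=\{v:h(v)>0\}$ with transition probabilities $p^h(x,y)=p(x,y)h(y)/h(x)$. The measure $\mu_h$ is a probability measure because $\Delta h(o)=1$ and $h(o)=0$. *)

(* Defs.v *)
From mathcomp Require Export all_boot all_order all_algebra.
From mathcomp Require Export all_classical all_reals all_analysis.

Set Implicit Arguments.
Unset Strict Implicit.
Unset Printing Implicit Defensive.

Import Order.TTheory GRing.Theory Num.Theory.
Import numFieldNormedType.Exports.

Local Open Scope classical_set_scope.
Local Open Scope ring_scope.

(* Loops are not excluded; they do not affect the Laplacian.  The field
   [cond_nonadj] fixes the value of [cond] on non-edges, where it has no
   meaning, so that [c x y] can be written for all pairs of vertices. *)
Record network (R : realType) (V : choiceType) := Network {
  adj : rel V;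
  cond : V -> V -> R;
  adj_sym : forall x y, adj x y = adj y x;
  cond_sym : forall x y, cond x y = cond y x;
  cond_gt0 : forall x y, adj x y -> 0 < cond x y;
  cond_nonadj : forall x y, ~~ adj x y -> cond x y = 0;
  infinite_network : infinite_set [set: V];
  locally_finite : forall x, finite_set [set y | adj x y];
  connected_network : forall x y, exists s, path adj x s /\ last x s = y
}.

Section Network.
Context {R : realType} {V : choiceType}.
Variable N : network R V.

Definition neighbours (x : V) : set V := [set y | adj N x y].

Definition total_cond (x : V) : R := \sum_(z \in neighbours x) cond N x z.

Definition walk_trans (x y : V) : R := cond N x y / total_cond x.

Definition laplacian (f : V -> R) (v : V) : R :=
  \sum_(x \in neighbours v) cond N v x * (f x - f v).

Definition potential (o : V) (h : V -> R) : Prop :=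
  [/\ forall v, 0 <= h v,
      h o = 0,
      laplacian h o = 1
    & forall v, v != o -> laplacian h v = 0].

Definition extremal_potential (o : V) (h : V -> R) : Prop :=
  potential o h /\
  forall (h1 h2 : V -> R) (t : R),
    potential o h1 -> potential o h2 -> 0 < t -> t < 1 ->
    (forall v, h v = t * h1 v + (1 - t) * h2 v) ->
    h1 = h2.

End Network.

(* The state space [S] carries the discrete sigma-algebra.  The Markov
   property P(Y_{n+1} = y | Y_0, ..., Y_n) = p(Y_n, y) is written without
   division, for every finite trajectory s 0, ..., s (n+1). *)
Definition markov_chain {R : realType} {d : measure_display}
    {T : measurableType d} (P : probability T R) (S : Type)
    (mu : S -> R) (p : S -> S -> R) (Y : nat -> T -> S) : Prop :=
  [/\ forall n (A : set S), measurable (Y n @^-1` A),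
      forall x : S, P [set w | Y 0%N w = x] = (mu x)%:E
    & forall n (s : nat -> S),
        P [set w | forall i, (i <= n.+1)%N -> Y i w = s i] =
        (P [set w | forall i, (i <= n)%N -> Y i w = s i]
          * (p (s n) (s n.+1))%:E)%E].

Section Walk.
Context {R : realType} {V : choiceType}.
Variable N : network R V.
Context {d : measure_display} {W : measurableType d}.
Variables (P : V -> probability W R) (X : nat -> W -> V).

Definition network_walk : Prop :=
  forall x, markov_chain (P x) (fun v => (v == x)%:R) (walk_trans N) X.

Definition recurrent_walk : Prop :=
  forall x, P x [set w | exists n, (0 < n)%N /\ X n w = x] = 1%E.

(* tau_o, equal to +oo if o is never hit. *)
Definition hitting_time (o : V) (w : W) : \bar R :=
  ereal_inf [set n%:R%:E | n in [set n : nat | X n w = o]].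

Definition green_density (o x y : V) : \bar R :=
  (((total_cond N y)^-1)%:E *
   \sum_(0 <= n <oo)
     P x [set w | X n w = y /\ (n%:R%:E < hitting_time o w)%E])%E.

End Walk.

Section HProcess.
Context {R : realType} {V : choiceType}.
Variables (N : network R V) (o : V) (h : V -> R).

Definition hstates : set V := [set v | 0 < h v].

Definition htrans (x y : hstates) : R :=
  walk_trans N (val x) (val y) * h (val y) / h (val x).

(* Vanishes at non-neighbours of [o], by [cond_nonadj]. *)
Definition hinit (v : hstates) : R := cond N o (val v) * h (val v).

End HProcess.

Arguments hinit {R V} N o h.
Arguments htrans {R V} N h.

(* Main.v *)
Require Import Defs.
From mathcomp Require Import all_boot all_order all_algebra.
From mathcomp Require Import all_classical all_reals all_analysis.
From mathcomp Require Import finmap measurable_realfun ring.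
Import Order.TTheory GRing.Theory Num.Theory.
Import numFieldNormedType.Exports.
Set Implicit Arguments.
Unset Strict Implicit.
Unset Printing Implicit Defensive.
Local Open Scope classical_set_scope.
Local Open Scope ring_scope.

(** Seen backwards from its last exit from a finite set [K], the h-process is
    the network walk run until it hits [o], and [g_o(x, .)] is superharmonic
    for that killed walk.  So the last exit from [K] is preceded by [k]
    upcrossings of [(a, b)] by [g_o(x, Y_n)] with probability at most
    [(a / b) ^ k], uniformly in [K]; letting [K] exhaust [V] gives the almost
    sure convergence.  Let [L_K] be the time of that last exit.  Splitting the
    event of a visit to [x] in [K] according to [Y_(L_K)] gives
    [E g_o(x, Y_(L_K)) = h x], and since [g_o(x, .)] is bounded,
    dominated convergence gives [E H x = h x].  Finally, if [h] is extremal,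
    writing [h] as the mixture of [E (H | A)] and [E (H | ~ A)] shows that
    [E (H x; A) = h x * P A] for every event [A], that is, [H x = h x] a.s. *)

(** * The walk killed at the root *)

(** Forwards in time, the supermartingale is [g_o(x, Y_n) / h (Y_n)], not [g_o(x, Y_n)], and
    [h (Y_n)] may be unbounded; hence the reversal. No reversed process is built: the laws of the
    h-process are written as densities with respect to [c * h], on which a step of the chain acts as
    a step of the killed walk. A last exit time is not a stopping time, but at each fixed time the
    Markov property separates the past from the event of never returning to [K]. What is left to
    estimate are expected numbers of visits, compared with [c * h] times a superharmonic function.
    The ratio [a / b] bounds the probability that a nonnegative superharmonic function climbs from
    [a] to [b] along the killed walk. Recurrence enters as the almost sure death of the killed walk:
    this bounds the Green function, makes [c * h] the occupation measure, and gives the limit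
    Laplacian 1 at [o]. *)

Section Network.
Context {R : realType} {V : choiceType}.
Variable N : network R V.

Local Notation c := (total_cond N).
Local Notation p := (walk_trans N).

Definition nb (x : V) : seq V := fset_set (neighbours N x).

Lemma mem_nb x z : (z \in nb x) = adj N x z.
Proof.
rewrite /nb in_fset_set; last exact: locally_finite.
by apply/idP/idP => [/set_mem|?]; last exact/mem_set.
Qed.

Lemma nb_sym x z : (z \in nb x) = (x \in nb z).
Proof. by rewrite !mem_nb adj_sym. Qed.

Lemma nb_uniq x : uniq (nb x).
Proof. exact: fset_uniq. Qed.

Lemma cond_ge0 x y : 0 <= cond N x y.
Proof.
have [/cond_gt0/ltW//|/(cond_nonadj)->//] := boolP (adj N x y).
Qed.

Lemma total_condE x : c x = \sum_(z <- nb x) cond N x z.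
Proof. by rewrite /total_cond fsbig_finite//; exact: locally_finite. Qed.

Lemma connected_ind (Q : V -> Prop) x :
  Q x -> (forall y z, adj N y z -> Q y -> Q z) -> forall z, Q z.
Proof.
move=> Qx Qadj z; have [s [+ <-]] := connected_network N x z.
elim: s x Qx => [//|y s IH] x Qx /= /andP[xy]; apply: IH; exact: Qadj xy Qx.
Qed.

Lemma has_neighbour x : exists y, adj N x y.
Proof.
apply: contrapT => noy; apply: (@infinite_network _ _ N).
suff -> : [set: V] = [set x] by exact: finite_set1.
apply/seteqP; split => // z _ /=.
apply: (@connected_ind (fun z => z = x) x) => // y t yt yx; case: noy.
by exists t; rewrite -yx.
Qed.

Lemma total_cond_gt0 x : 0 < c x.
Proof.
have [y xy] := has_neighbour x.
rewrite total_condE (big_rem y) ?mem_nb//= ltr_wpDr ?cond_gt0//.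
by apply: sumr_ge0 => *; exact: cond_ge0.
Qed.

Lemma total_cond_neq0 x : c x != 0.
Proof. by rewrite gt_eqF ?total_cond_gt0. Qed.

Lemma walk_trans_ge0 x y : 0 <= p x y.
Proof. by rewrite divr_ge0 ?cond_ge0// ltW ?total_cond_gt0. Qed.

Lemma walk_trans_gt0 x y : adj N x y -> 0 < p x y.
Proof. by move=> xy; rewrite divr_gt0 ?cond_gt0 ?total_cond_gt0. Qed.

Lemma walk_trans_nonadj x y : ~~ adj N x y -> p x y = 0.
Proof. by move=> xy; rewrite /walk_trans cond_nonadj ?mul0r. Qed.

Lemma total_condM x y : c x * p x y = cond N x y.
Proof. by rewrite /walk_trans mulrC divfK ?total_cond_neq0. Qed.

Lemma walk_trans_sum1 x : \sum_(z <- nb x) p x z = 1.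
Proof. by rewrite -mulr_suml -total_condE divff ?total_cond_neq0. Qed.

Lemma laplacianE f v :
  laplacian N f v = c v * (\sum_(z <- nb v) p v z * f z - f v).
Proof.
rewrite /laplacian fsbig_finite; last exact: locally_finite.
rewrite mulrBr mulr_sumr {2}total_condE mulr_suml -sumrB.
by apply: eq_bigr => z _; rewrite mulrA total_condM mulrBr.
Qed.

Lemma countable_vertices : countable [set: V].
Proof.
have [->|/set0P[v0 _]] := eqVneq [set: V] set0; first exact: countable0.
pose D := fix D n := if n is m.+1 then \bigcup_(x in D m) neighbours N x
                     else [set v0].
have -> : [set: V] = \bigcup_n D n.
  apply/seteqP; split => // z _.
  apply: (@connected_ind (fun z => (\bigcup_n D n) z) v0); first by exists 0%N.
  by move=> y t yt [n _ Dy]; exists n.+1 => //; exists y.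
apply: bigcup_countable => // n _; elim: n => [|n IH] /=; first exact: countable1.
apply: bigcup_countable => // x _; apply: finite_set_countable.
exact: locally_finite.
Qed.

Variable o : V.

(** Killing takes place on leaving [o]: [Q n f y] is the expectation of [f (X_n)] over walks from
    [y] with [tau_o >= n]. It is the killed semigroup on functions vanishing at [o], hence the
    hypotheses [f o = 0] below. *)
Definition killed (f : V -> R) (y : V) : R :=
  if y == o then 0 else \sum_(z <- nb y) p y z * f z.

Definition iter_killed n := iter n killed.
Local Notation Q := iter_killed.

Lemma killedo f : killed f o = 0.
Proof. by rewrite /killed eqxx. Qed.

Lemma killedE f y : y != o -> killed f y = \sum_(z <- nb y) p y z * f z.
Proof. by rewrite /killed => /negbTE->. Qed.

Lemma killed_ge0 f : (forall y, 0 <= f y) -> forall y, 0 <= killed f y.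
Proof.
move=> f0 y; rewrite /killed; case: ifP => // _.
by apply: sumr_ge0 => z _; rewrite mulr_ge0 ?walk_trans_ge0.
Qed.

Lemma le_killed f g : (forall y, f y <= g y) -> forall y, killed f y <= killed g y.
Proof.
move=> fg y; rewrite /killed; case: ifP => // _.
by apply: ler_sum => z _; rewrite ler_wpM2l ?walk_trans_ge0.
Qed.

Lemma eq_killed f g : f =1 g -> killed f =1 killed g.
Proof.
by move=> fg y; rewrite /killed; under eq_bigr do rewrite fg.
Qed.

Lemma killedZ a f y : killed (fun z => a * f z) y = a * killed f y.
Proof.
rewrite /killed; case: ifP => _; first by rewrite mulr0.
by rewrite mulr_sumr; apply: eq_bigr => z _; rewrite mulrCA.
Qed.

Lemma killed_sum (I : Type) (s : seq I) (f : I -> V -> R) y :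
  killed (fun z => \sum_(i <- s) f i z) y = \sum_(i <- s) killed (f i) y.
Proof.
rewrite /killed; case: ifP => _; first by rewrite big1.
rewrite exchange_big /=; apply: eq_bigr => z _.
by rewrite mulr_sumr.
Qed.

Lemma iter_killedS n f : Q n.+1 f = killed (Q n f).
Proof. by []. Qed.

Lemma iter_killedD m n f : Q (m + n) f = Q m (Q n f).
Proof. exact: iterD. Qed.

Lemma iter_killed_ge0 n f : (forall y, 0 <= f y) -> forall y, 0 <= Q n f y.
Proof. by move=> f0; elim: n => // n IH y; exact: killed_ge0. Qed.

Lemma le_iter_killed n f g :
  (forall y, f y <= g y) -> forall y, Q n f y <= Q n g y.
Proof. by move=> fg; elim: n => // n IH y; exact: le_killed. Qed.

Lemma iter_killedo n f : f o = 0 -> Q n f o = 0.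
Proof. by case: n => // n _; rewrite iter_killedS killedo. Qed.

Lemma iter_killedZ n a f y : Q n (fun z => a * f z) y = a * Q n f y.
Proof.
elim: n y => // n IH y; rewrite !iter_killedS (eq_killed IH) killedZ //.
Qed.

(** [Q n alive y] is the probability of [tau_o > n] for the walk from [y], and [Q n exit_prob y],
    for [y != o], that of [tau_o = n + 1]. *)
Definition alive (y : V) : R := (y != o)%:R.
Definition exit_prob (y : V) : R := if y == o then 0 else p y o.
Local Notation r := exit_prob.

Lemma alive_ge0 y : 0 <= alive y. Proof. exact: ler0n. Qed.
Lemma aliveo : alive o = 0. Proof. by rewrite /alive eqxx. Qed.

Lemma exit_prob_ge0 y : 0 <= r y.
Proof. by rewrite /r; case: ifP => // _; exact: walk_trans_ge0. Qed.

Lemma exit_probo : r o = 0. Proof. by rewrite /r eqxx. Qed.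

Lemma killed_aliveE y : killed alive y + r y = alive y.
Proof.
rewrite /killed /r /alive; case: ifPn => [_|yo] /=; first by rewrite addr0.
rewrite -[RHS](walk_trans_sum1 y).
have [yo'|yo'] := boolP (o \in nb y).
  rewrite (big_rem o)//= [in RHS](big_rem o)//= eqxx mulr0 add0r addrC.
  congr (_ + _); rewrite rem_filter ?nb_uniq// !big_filter.
  by apply: eq_bigr => z /= ->; rewrite mulr1.
rewrite walk_trans_nonadj -?mem_nb// addr0.
rewrite [LHS]big_seq [RHS]big_seq; apply: eq_bigr => z zy.
by case: eqVneq => [zo|_]; [rewrite -zo zy in yo'|rewrite mulr1].
Qed.

Lemma killed_alive_le y : killed alive y <= alive y.
Proof. by rewrite -(killed_aliveE y) lerDl exit_prob_ge0. Qed.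

Lemma sum_iter_exit n y : \sum_(k < n) Q k r y = alive y - Q n alive y.
Proof.
suff : \sum_(k < n) Q k r y + Q n alive y = alive y by move=> <-; rewrite addrK.
elim: n y => [|n IH] y; first by rewrite big_ord0 add0r.
rewrite big_ord_recl /= -[RHS]killed_aliveE -(eq_killed IH).
rewrite addrC [RHS]addrC addrA [_ + r y]addrC -addrA; congr (_ + _).
rewrite [RHS]/killed; case: ifP => [/eqP->|yo].
  rewrite killedo add0r big1// => k _; by rewrite killedo.
rewrite [LHS]addrC.
under [in RHS]eq_bigr do rewrite mulrDr mulr_sumr.
rewrite big_split exchange_big /= /killed yo; congr (_ + _).
Qed.

Lemma sum_iter_exit_le1 n y : \sum_(k < n) Q k r y <= 1.
Proof.
rewrite sum_iter_exit; apply: (@le_trans _ _ (alive y)).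
  by rewrite gerBl iter_killed_ge0// => z; exact: alive_ge0.
by rewrite lern1 leq_b1.
Qed.

(** Iterated in the second variable, along which the h-process moves, so that superharmonicity there
    is immediate. By reversibility this is the [n]-th term of [g_o(x, y)]. *)
Definition green_term (n : nat) (x : V) : V -> R :=
  Q n (fun y => ((y == x) && (y != o))%:R / c x).
Local Notation kk := green_term.

Lemma green_term0_ge0 x y : 0 <= ((y == x) && (y != o))%:R / c x.
Proof. by rewrite divr_ge0 // ltW ?total_cond_gt0. Qed.

Lemma green_term_ge0 n x y : 0 <= kk n x y.
Proof. exact/iter_killed_ge0/green_term0_ge0. Qed.

Lemma green_termo n x : kk n x o = 0.
Proof. by apply: iter_killedo => /=; rewrite ?eqxx ?andbF ?mul0r. Qed.

Lemma green_termol n y : kk n o y = 0.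
Proof.
apply/eqP; rewrite eq_le green_term_ge0 andbT.
have -> : 0 = Q n (fun=> 0) y.
  elim: n y => // n IH y; rewrite iter_killedS -(eq_killed IH) /killed.
  by case: ifP => // _; rewrite big1// => *; rewrite mulr0.
apply: le_iter_killed => z; case: eqVneq => //= [_|_]; by rewrite ?mul0r.
Qed.

(* The recursion in the first variable; it holds because conductances are
   symmetric, so that each [green_term n] is symmetric. *)
Lemma green_termS n x y : x != o ->
  kk n.+1 x y = \sum_(z <- nb x) p x z * kk n z y.
Proof.
move=> xo; elim: n y => [|n IH] y.
  have [->|yo] := eqVneq y o.
    by rewrite green_termo big1// => z _; rewrite green_termo mulr0.
  rewrite /kk /= killedE//.
  have [xy|xy] := boolP (y \in nb x); last first.
    rewrite !big_seq !big1 // => z.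
      by case: eqVneq => [<-/(negP xy)//|_ _]; rewrite mul0r mulr0.
    by rewrite nb_sym; case: eqVneq => [-> /(negP xy)//|_ _]; rewrite mul0r mulr0.
  rewrite (bigD1_seq x) ?nb_uniq ?(nb_sym y)//= [RHS](bigD1_seq y) ?nb_uniq//=.
  rewrite eqxx xo eqxx yo /= !big1 ?addr0; last 2 first.
  - by move=> z zy; rewrite eq_sym (negbTE zy) mul0r mulr0.
  - by move=> z /negbTE->; rewrite mul0r mulr0.
  by rewrite /walk_trans (cond_sym N y x) !mul1r -!mulrA; congr (_ * _); rewrite mulrC.
rewrite [LHS]/kk iter_killedS (eq_killed IH) killed_sum.
by apply: eq_bigr => z _; rewrite killedZ.
Qed.

(** For [n = 0] this is [c_oy / c_y = p(y, o)]; linearity of [killed] does the rest. *)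
Lemma sum_cond_green_term n y :
  \sum_(x <- nb o) cond N o x * kk n x y = Q n r y.
Proof.
elim: n y => [|n IH] y.
  have [->|yo] := eqVneq y o.
    by rewrite (iter_killedo _ exit_probo) big1// => z _; rewrite green_termo mulr0.
  rewrite /kk /= /r (negbTE yo).
  have [oy|oy] := boolP (y \in nb o).
    rewrite (bigD1_seq y) ?nb_uniq//= eqxx big1 ?addr0 /=.
      by rewrite cond_sym mul1r.
    by move=> z zy; rewrite eq_sym (negbTE zy) mul0r mulr0.
  rewrite walk_trans_nonadj -?mem_nb 1?nb_sym// big_seq big1// => z zo.
  by case: eqVneq => [yz|_]; [rewrite yz zo in oy|rewrite mul0r mulr0].
rewrite iter_killedS -(eq_killed IH) killed_sum.
by apply: eq_bigr => z _; rewrite killedZ.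
Qed.

End Network.

(** * The Green function under recurrence *)

Section RecurrentNetwork.
Context {R : realType} {V : choiceType}.
Variables (N : network R V) (o : V).

Local Notation c := (total_cond N).
Local Notation p := (walk_trans N).
Local Notation Q := (iter_killed N o).
Local Notation r := (exit_prob N o).
Local Notation kk := (green_term N o).

Definition green (x y : V) : R := limn (series (fun n => kk n x y)).

(* Recurrence: the walk a.s. hits [o]. *)
Hypothesis alive_cvg0 : forall y, Q n (alive o) y @[n --> \oo] --> (0 : R).

Lemma cvg_series_exit y : series (fun n => Q n r y) @ \oo --> (alive o y : R).
Proof.
have -> : series (fun n => Q n r y) = fun n => alive o y - Q n (alive o) y.
  by apply/funext => n; rewrite /series /= big_mkord sum_iter_exit.
rewrite -[X in _ --> X]subr0; apply: cvgB => //; exact: cvg_cst.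
Qed.

Arguments cvg_series_exit : clear implicits.

Lemma iter_exit_ge0 n y : 0 <= Q n r y.
Proof. by apply: iter_killed_ge0 => z; exact: exit_prob_ge0. Qed.

Lemma exit_gt0 x : x != o -> exists m, 0 < Q m r x.
Proof.
move=> xo; apply: contrapT => no.
have Q0 n : Q n r x = 0.
  apply/eqP; rewrite eq_le iter_exit_ge0 andbT leNgt; apply/negP => ?.
  by apply: no; exists n.
have := cvg_series_exit x.
have -> : series (fun n => Q n r x) = fun=> 0.
  by apply/funext => n; rewrite /series /= big1.
move=> /(cvg_lim (@Rhausdorff R)); rewrite lim_cst//.
by rewrite /alive xo => /esym/eqP; rewrite oner_eq0.
Qed.

(** A visit to [x] is followed, [m + 1] steps later, by the death of the walk with probability
    [Q m r x]. Deaths at different times exclude each other, so at most [1 / Q m r x] visits are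
    expected, whatever the start [y]. *)
Lemma green_bounded x : exists2 M, 0 <= M &
  forall n y, \sum_(k < n) kk k x y <= M.
Proof.
have [->|/exit_gt0[m m0]] := eqVneq x o.
  by exists 0 => // n y; rewrite big1// => k _; rewrite green_termol.
exists (c x * Q m r x)^-1.
  by rewrite invr_ge0 mulr_ge0 ?ltW ?total_cond_gt0.
move=> n y; rewrite -[leRHS]mul1r ler_pdivlMr ?mulr_gt0 ?total_cond_gt0//.
rewrite mulr_suml; apply: (@le_trans _ _ (\sum_(k < n) Q k (Q m r) y)).
  apply: ler_sum => k _; rewrite mulrC -(@iter_killedZ _ _ N o k).
  apply: le_iter_killed => z; rewrite mulrAC [c x * _]mulrC.
  rewrite divfK ?total_cond_neq0//.
  case: eqVneq => [->|_]; last by rewrite mul0r iter_exit_ge0.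
  by rewrite -[leRHS]mul1r ler_wpM2r ?iter_exit_ge0// lern1 leq_b1.
under eq_bigr do rewrite -iter_killedD.
apply: le_trans (sum_iter_exit_le1 N o (n + m) y).
rewrite -[leRHS](big_mkord predT (fun k => Q k r y)).
rewrite -[leLHS](big_mkord predT (fun k => Q (k + m) r y)).
rewrite [leRHS](@big_cat_nat _ _ _ m)//= ?leq_addl//.
have -> : \sum_(m <= i < n + m) Q i r y = \sum_(0 <= k < n) Q (k + m) r y.
  by rewrite -{1}[m]add0n big_addn addnK.
by rewrite lerDr sumr_ge0// => k _; exact: iter_exit_ge0.
Qed.

Lemma cvg_green x y : series (fun n => kk n x y) @ \oo --> green x y.
Proof.
apply: nondecreasing_is_cvgn.
  apply/nondecreasing_seqP => n; rewrite seriesSr lerDl; exact: green_term_ge0.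
have [M _ HM] := green_bounded x.
by exists M => _ [n _ <-]; rewrite /series /= big_mkord.
Qed.

Arguments cvg_green : clear implicits.

Lemma green_le x : exists2 M, 0 <= M & forall y, green x y <= M.
Proof.
have [M M0 HM] := green_bounded x; exists M => // y.
apply: limr_le; first exact: cvg_green.
by near=> n; rewrite /series /= big_mkord.
Unshelve. all: by end_near. Qed.

Lemma green_ge0 x y : 0 <= green x y.
Proof.
apply: limr_ge; first exact: cvg_green.
near=> n; rewrite /series /= sumr_ge0// => k _; exact: green_term_ge0.
Unshelve. all: by end_near. Qed.

Lemma cvg_sum_seq (I : eqType) (s : seq I) (a : I -> R) (F : I -> nat -> R)
    (l : I -> R) :
  (forall i, i \in s -> F i @ \oo --> l i) ->
  (\sum_(i <- s) a i * F i n) @[n --> \oo] --> \sum_(i <- s) a i * l i.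
Proof.
elim: s => [|i s IH] Fl.
  rewrite big_nil; under eq_fun do rewrite big_nil; exact: cvg_cst.
rewrite big_cons; under eq_fun do rewrite big_cons; apply: cvgD.
  by apply: cvgMr; apply: Fl; rewrite mem_head.
by apply: IH => j js; apply: Fl; rewrite in_cons js orbT.
Qed.

Lemma cvgn_unique (u : nat -> R) (a b : R) :
  u @ \oo --> a -> u @ \oo --> b -> a = b.
Proof. by move=> /(cvg_lim (@Rhausdorff R)) <- /(cvg_lim (@Rhausdorff R)). Qed.

Lemma greeno x : green x o = 0.
Proof.
rewrite /green (_ : series _ = fun=> 0) ?lim_cst//.
by apply/funext => n; rewrite /series /= big1// => k _; rewrite green_termo.
Qed.

Lemma greenol y : green o y = 0.
Proof.
rewrite /green (_ : series _ = fun=> 0) ?lim_cst//.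
by apply/funext => n; rewrite /series /= big1// => k _; rewrite green_termol.
Qed.

Lemma killed_greenE x y :
  killed N o (green x) y = green x y - kk 0 x y.
Proof.
have [->|yo] := eqVneq y o; first by rewrite killedo greeno green_termo subrr.
rewrite killedE//.
have S n : \sum_(z <- nb N y) p y z * series (fun n => kk n x z) n
    = series (fun n => kk n x y) n.+1 - kk 0 x y.
  rewrite /series /= big_mkord big_ord_recl addrC addKr.
  under eq_bigr do rewrite big_mkord mulr_sumr.
  by rewrite exchange_big /=; apply: eq_bigr => k _; rewrite -(killedE N (kk k x) yo).
apply: (cvgn_unique (cvg_sum_seq (a := p y) (fun z (_ : z \in nb N y) => cvg_green x z))).
under eq_fun do rewrite S.
apply: cvgB; last exact: cvg_cst.
by rewrite (cvg_shiftS (series (fun n => kk n x y))); exact: cvg_green.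
Qed.

Lemma killed_green_le x y : killed N o (green x) y <= green x y.
Proof. by rewrite killed_greenE gerBl green_term_ge0. Qed.

(** The pole of [g_o(., y)] is at [y]; along a transient trajectory it leaves every fixed [x], which
    makes the limit harmonic off [o]. *)
Lemma green_harmonicl x y : x != o -> y != x ->
  \sum_(z <- nb N x) p x z * green z y = green x y.
Proof.
move=> xo yx.
have S n : \sum_(z <- nb N x) p x z * series (fun n => kk n z y) n
    = series (fun n => kk n x y) n.+1.
  rewrite /series /= big_mkord big_ord_recl /=.
  rewrite [X in X + _](_ : _ = 0); last by rewrite /kk /= (negbTE yx) mul0r.
  rewrite add0r; under eq_bigr do rewrite big_mkord mulr_sumr.
  by rewrite exchange_big /=; apply: eq_bigr => k _; rewrite -(green_termS N k y xo).
apply: (cvgn_unique (cvg_sum_seq (a := p x) (fun z (_ : z \in nb N x) => cvg_green z y))).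
rewrite (_ : (fun n => _) = [sequence series (fun n => kk n x y) n.+1]_n).
  by rewrite cvg_shiftS; exact: cvg_green.
by apply/funext => n; exact: S.
Qed.

(** The walk from [y] dies with total probability 1. Hence [g_o(., y)] has Laplacian 1 at [o] for
    every pole [y != o], and so has the limit. *)
Lemma sum_cond_green y : \sum_(x <- nb N o) cond N o x * green x y = alive o y.
Proof.
apply: (cvgn_unique (cvg_sum_seq (a := cond N o)
  (fun z (_ : z \in nb N o) => cvg_green z y))).
rewrite (_ : (fun n => _) = series (fun n => Q n r y)); first exact: cvg_series_exit.
apply/funext => n; rewrite /series /=; under eq_bigr do rewrite mulr_sumr.
by rewrite exchange_big /=; apply: eq_bigr => k _; exact: sum_cond_green_term.
Qed.

End RecurrentNetwork.

(** * Potentials and the Doob transform *)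

Section Potential.
Context {R : realType} {V : choiceType}.
Variables (N : network R V) (o : V) (h : V -> R).

Local Notation c := (total_cond N).
Local Notation p := (walk_trans N).
Local Notation Q := (iter_killed N o).
Local Notation kk := (green_term N o).

Lemma potentialP :
  potential N o h <->
  [/\ forall v, 0 <= h v, h o = 0, \sum_(x <- nb N o) cond N o x * h x = 1
    & forall v, v != o -> \sum_(z <- nb N v) p v z * h z = h v].
Proof.
have L1 : h o = 0 -> laplacian N h o = \sum_(x <- nb N o) cond N o x * h x.
  move=> ho; rewrite laplacianE ho subr0 mulr_sumr.
  by apply: eq_bigr => x _; rewrite mulrA total_condM.
split=> -[h0 ho h1 hharm]; split=> //.
- by rewrite -L1.
- move=> v /hharm/eqP; rewrite laplacianE mulf_eq0 (negbTE (total_cond_neq0 N v)) /=.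
  by rewrite subr_eq0 => /eqP.
- by rewrite L1.
- by move=> v /hharm; rewrite laplacianE => ->; rewrite subrr mulr0.
Qed.

Hypothesis pot_h : potential N o h.

Lemma potential_ge0 v : 0 <= h v. Proof. by have [] := pot_h. Qed.
Lemma potentialo : h o = 0. Proof. by have [] := pot_h. Qed.

(** A nonnegative average vanishes only if all its terms do. Hence the support of [h] is a union of
    connected components of the graph without [o]. *)
Lemma potential_zero_adj y z : z != o -> adj N z y -> h z = 0 -> h y = 0.
Proof.
move=> zo zy hz; have /potentialP[h0 _ _ /(_ z zo)] := pot_h.
rewrite hz => /eqP; rewrite psumr_eq0; last first.
  by move=> x _; rewrite mulr_ge0 ?walk_trans_ge0.
move=> /allP/(_ y); rewrite mem_nb => /(_ zy); rewrite mulf_eq0.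
by rewrite (gt_eqF (walk_trans_gt0 zy)) => /eqP.
Qed.

(* [0] when [h x = 0], since [x / 0 = 0]. *)
Definition doob_trans (x y : V) : R := p x y * h y / h x.

Lemma doob_trans_ge0 x y : 0 <= doob_trans x y.
Proof.
apply: mulr_ge0; last by rewrite invr_ge0 potential_ge0.
by apply: mulr_ge0; [exact: walk_trans_ge0|exact: potential_ge0].
Qed.

Lemma doob_trans_nonadj x y : ~~ adj N x y -> doob_trans x y = 0.
Proof. by move=> xy; rewrite /doob_trans walk_trans_nonadj// !mul0r. Qed.

Lemma sum_doob_trans_le1 x : \sum_(z <- nb N x) doob_trans x z <= 1.
Proof.
have [hx|hx] := eqVneq (h x) 0.
  by rewrite big1// => z _; rewrite /doob_trans hx invr0 mulr0.
have xo : x != o by apply: contra_neq hx => ->; exact: potentialo.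
have /potentialP[_ _ _ /(_ x xo) E] := pot_h.
by rewrite -mulr_suml E divff.
Qed.

(* The time reversal of the h-process with respect to the measure [c * h] is
   the original walk killed at [o]. *)
Lemma doob_reversal (f : V -> R) z : f o = 0 ->
  \sum_(y <- nb N z) c y * h y * f y * doob_trans y z
  = c z * h z * killed N o f z.
Proof.
move=> fo; have [hz|hz] := eqVneq (h z) 0.
  by rewrite hz mulr0 mul0r big1// => y _; rewrite /doob_trans hz mulr0 mul0r mulr0.
have zo : z != o by apply: contra_neq hz => ->; exact: potentialo.
rewrite killedE// mulr_sumr big_seq [RHS]big_seq; apply: eq_bigr => y.
rewrite mem_nb => zy; have [->|yo] := eqVneq y o; first by rewrite fo !(mulr0,mul0r).
have hy : h y != 0.
  by apply: contra_neq hz; apply: potential_zero_adj => //; rewrite adj_sym.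
rewrite /doob_trans [in RHS]mulrA [c z * h z]mulrC -[_ * c z * _]mulrA total_condM.
rewrite cond_sym -total_condM; field; exact: hy.
Qed.

Lemma doob_reversal_le (q f : V -> R) z : f o = 0 ->
  (forall y, q y <= c y * h y * f y) ->
  \sum_(y <- nb N z) q y * doob_trans y z <= c z * h z * killed N o f z.
Proof.
move=> fo qf; rewrite -doob_reversal//; apply: ler_sum => y _.
by rewrite ler_wpM2r// doob_trans_ge0.
Qed.

(** The killed walk cannot pass from the support of [h] to a vertex [x] outside it. This serves the
    vertices with [h x = 0], to which the last-exit identity does not apply. *)
Lemma green_term_potential0 n x y : h x = 0 -> kk n x y * h y = 0.
Proof.
move=> hx; elim: n y => [|n IH] y.
  by rewrite /kk /=; case: eqVneq => [->|_]; rewrite ?hx ?mulr0 ?mul0r.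
have [->|hy] := eqVneq (h y) 0; first by rewrite mulr0.
have yo : y != o by apply: contra_neq hy => ->; exact: potentialo.
rewrite -[kk n.+1 x]/(killed N o (kk n x)) killedE// big_seq big1 ?mul0r// => z.
rewrite mem_nb => yz.
have [->|zo] := eqVneq z o; first by rewrite green_termo mulr0.
have hz : h z != 0.
  by apply: contra_neq hy; apply: potential_zero_adj => //; rewrite adj_sym.
by have /eqP := IH z; rewrite mulf_eq0 (negbTE hz) orbF => /eqP ->; rewrite mulr0.
Qed.

Lemma green_potential0 x y : h x = 0 -> 0 < h y -> green N o x y = 0.
Proof.
move=> hx hy.
rewrite /green (_ : series _ = fun=> 0) ?lim_cst//.
apply/funext => n; rewrite /series /= big1// => k _; apply/eqP.
by have /eqP := green_term_potential0 k y hx; rewrite mulf_eq0 (gt_eqF hy) orbF.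
Qed.

End Potential.

(** * Finite trajectories of Markov chains *)

Section RealProbability.
Context {R : realType} {d : measure_display} {T : measurableType d}.
Variable P : probability T R.

Definition rprob (A : set T) : R := fine (P A).
Local Notation pr := rprob.

Lemma prE A : measurable A -> P A = (pr A)%:E.
Proof. by move=> mA; rewrite /pr fineK// fin_num_measure. Qed.

Lemma pr_ge0 A : 0 <= pr A.
Proof. by rewrite fine_ge0. Qed.

Lemma pr0 : pr set0 = 0.
Proof. by rewrite /pr measure0. Qed.

Lemma prT : pr setT = 1.
Proof. by rewrite /pr probability_setT. Qed.

Lemma le_pr A B : measurable A -> measurable B -> A `<=` B -> pr A <= pr B.
Proof.
by move=> mA mB AB; rewrite -lee_fin -!prE//; apply: le_measure => //; exact/mem_set.
Qed.

Lemma pr_le1 A : measurable A -> pr A <= 1.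
Proof. by move=> mA; rewrite -prT le_pr. Qed.

Lemma pr_eq0 A : measurable A -> P.-negligible A -> pr A = 0.
Proof. by move=> mA /negligibleP-/(_ mA); rewrite /pr => ->. Qed.

Lemma prU A B : measurable A -> measurable B -> A `&` B = set0 ->
  pr (A `|` B) = pr A + pr B.
Proof.
move=> mA mB AB; apply: EFin_inj; rewrite EFinD -!prE ?measureU//.
exact: measurableU.
Qed.

Lemma cvg_pr_bigcup (F : (set T)^nat) : (forall n, measurable (F n)) ->
  nondecreasing_seq F -> pr (F n) @[n --> \oo] --> pr (\bigcup_n F n).
Proof.
move=> mF ndF; have mU : measurable (\bigcup_n F n) by exact: bigcupT_measurable.
apply: fine_cvg; rewrite -prE//; exact: nondecreasing_cvg_mu.
Qed.

Lemma cvg_pr_bigcap (F : (set T)^nat) : (forall n, measurable (F n)) ->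
  nonincreasing_seq F -> pr (F n) @[n --> \oo] --> pr (\bigcap_n F n).
Proof.
move=> mF ndF; have mU : measurable (\bigcap_n F n) by exact: bigcapT_measurable.
apply: fine_cvg; rewrite -prE//; apply: nonincreasing_cvg_mu => //.
by rewrite (le_lt_trans (probability_le1 _ _))// ltry.
Qed.

Lemma cvg_series_pr (F : (set T)^nat) : (forall n, measurable (F n)) ->
  trivIset setT F -> series (fun n => pr (F n)) @ \oo --> pr (\bigcup_n F n).
Proof.
move=> mF tF; have mU : measurable (\bigcup_n F n) by exact: bigcupT_measurable.
have -> : series (fun n => pr (F n)) = fun n => fine (\sum_(0 <= i < n) P (F i))%E.
  apply/funext => n; rewrite /series /=.
  by under [X in fine X]eq_bigr do rewrite prE//; rewrite sumEFin.
apply: fine_cvg; rewrite -prE//; exact: measure_semi_sigma_additive.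
Qed.

Lemma le_pr_ae (A B G : set T) : measurable A -> measurable B ->
  P.-negligible (~` G) -> (forall w, G w -> A w -> B w) -> pr A <= pr B.
Proof.
move=> mA mB [Nl [mN N0 GN]] AB.
have -> : pr B = pr (B `|` Nl) by rewrite /pr measureU0.
apply: le_pr => //; first exact: measurableU.
move=> w Aw; have [Gw|nGw] := pselect (G w); first by left; exact: AB.
by right; exact: GN.
Qed.

Lemma eq_pr_ae (A B G : set T) : measurable A -> measurable B ->
  P.-negligible (~` G) -> (forall w, G w -> A w <-> B w) -> pr A = pr B.
Proof.
move=> mA mB nG AB; apply/eqP; rewrite eq_le; apply/andP.
by split; apply: le_pr_ae nG _ => // w Gw /(AB w Gw).
Qed.

(** Up to a null set, [A] lies in the increasing union of the sets [L n], each inside [F n]. This is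
    how a bound uniform in finite sets [K] survives the exhaustion of [V]. *)
Lemma pr_eventually_le (F : (set T)^nat) (A G : set T) (e : R) :
  (forall n, measurable (F n)) -> measurable A -> P.-negligible (~` G) ->
  (forall n, pr (F n) <= e) ->
  (forall w, G w -> A w -> \forall n \near \oo, F n w) -> pr A <= e.
Proof.
move=> mF mA nG Fe AF.
pose L n := \bigcap_(k in [set k | (n <= k)%N]) F k.
have mL n : measurable (L n) by apply: bigcap_measurable => //; exists n => /=.
have ndL : nondecreasing_seq L.
  move=> m n mn; apply/subsetPset => w Lw k /= nk; apply: Lw => /=.
  exact: leq_trans nk.
have Ll := cvg_pr_bigcup mL ndL.
apply: (@le_trans _ _ (pr (\bigcup_n L n))).
  by apply: le_pr_ae nG _ => //; exact: bigcupT_measurable.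
rewrite -(cvg_lim (@Rhausdorff R) Ll); apply: limr_le.
  by apply/cvg_ex; exists (pr (\bigcup_n L n)).
near=> n; apply: le_trans (Fe n); apply: le_pr => //.
by move=> w; apply => /=.
Unshelve. all: by end_near. Qed.

End RealProbability.
Arguments cvg_pr_bigcup {R d T} P {F}.
Arguments cvg_pr_bigcap {R d T} P {F}.
Arguments cvg_series_pr {R d T} P {F}.

Section DiscreteVariable.
Context {R : realType} {d : measure_display} {T : measurableType d}.
Variable P : probability T R.
Context {V : choiceType}.
Hypothesis countV : countable [set: V].
Variable Z : T -> V.
Hypothesis mZ : forall A : set V, measurable (Z @^-1` A).

Lemma measurable_eqZ v : measurable [set w | Z w = v].
Proof. exact: (mZ [set v]). Qed.

(** The null events for the vertices outside [s] have a null union because [V] is countable. *)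
Lemma pr_sum_seq (A : set T) (s : seq V) : measurable A -> uniq s ->
  (forall v, v \notin s -> rprob P (A `&` [set w | Z w = v]) = 0) ->
  rprob P A = \sum_(v <- s) rprob P (A `&` [set w | Z w = v]).
Proof.
move=> mA us A0.
have fin (s' : seq V) : uniq s' ->
    rprob P (A `&` Z @^-1` [set` s'])
    = \sum_(v <- s') rprob P (A `&` [set w | Z w = v]).
  elim: s' => [_|v s' IH /= /andP[vs us']].
    rewrite big_nil (_ : _ `&` _ = set0) ?pr0//.
    by apply/seteqP; split => // w [].
  rewrite big_cons -IH// -prU//; last 3 first.
  - by apply: measurableI => //; exact: measurable_eqZ.
  - by apply: measurableI.
  - by apply/seteqP; split => // w [[_ /= ->] [_ /=]]; rewrite (negbTE vs).
  congr rprob; apply/seteqP; split => w /=.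
    by move=> [Aw]; rewrite in_cons => /orP[/eqP ?|?]; [left|right].
  by move=> [|] [Aw] => [->|Zs]; split; rewrite // in_cons ?eqxx ?Zs ?orbT.
rewrite -fin//.
have [f finj] := countable_injP _ countV.
apply: (@eq_pr_ae _ _ _ P _ _ (~` (A `&` Z @^-1` [set v | v \notin s]))) => //.
- exact: measurableI.
- rewrite setCK.
  apply: (@negligibleS _ _ _ P
      (\bigcup_k (A `&` Z @^-1` [set v | v \notin s /\ f v = k]))).
    by move=> w [Aw Zw]; exists (f (Z w)).
  apply: negligible_bigcup => k.
  have [[v [vs fv]]|no] := pselect (exists v, v \notin s /\ f v = k).
    apply: (@negligibleS _ _ _ P (A `&` [set w | Z w = v])).
      move=> w [Aw [Zs fZ]]; split => //=.
      by apply: finj; rewrite ?in_setT// fZ fv.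
    have mAv : measurable (A `&` [set w | Z w = v]).
      by apply: measurableI => //; exact: measurable_eqZ.
    have PAv : P (A `&` [set w | Z w = v]) = 0%E by rewrite (prE P mAv) A0.
    exact/(negligibleP P mAv).
  rewrite (_ : _ `&` _ = set0); first exact: negligible_set0.
  by apply/seteqP; split => // w [_ [? ?]]; case: no; exists (Z w).
- move=> w nw; split => [Aw|[]//]; split => //=.
  by apply: contrapT => /negP Zs; apply: nw.
Qed.

End DiscreteVariable.

(** * The Markov property for events of the past *)

Section ChainHistory.
Context {R : realType} {V : choiceType} (N : network R V).
Context {d : measure_display} {T : measurableType d}.
Variable P : probability T R.
Variables (mu : V -> R) (q : V -> V -> R) (Z : nat -> T -> V).
Hypothesis chainZ : markov_chain P mu q Z.
Local Notation pr := (rprob P).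
Local Notation countV := (countable_vertices N).

Lemma measurable_chain n (A : set V) : measurable (Z n @^-1` A).
Proof. by have [] := chainZ. Qed.

Lemma measurable_at n v : measurable [set w | Z n w = v].
Proof. exact: (measurable_chain n [set v]). Qed.

(** Stands for membership in the sigma-algebra of the first [n + 1] positions; measurability is not
    demanded, as it follows from the countability of [V]. *)
Definition adapted n (A : set T) :=
  forall w w', (forall i, (i <= n)%N -> Z i w = Z i w') -> A w -> A w'.

Lemma adaptedT n : adapted n setT. Proof. by []. Qed.

Lemma adapted_at n v : adapted n [set w | Z n w = v].
Proof. by move=> w w' /(_ n (leqnn n)) /= <-. Qed.

Lemma adaptedI n A B : adapted n A -> adapted n B -> adapted n (A `&` B).
Proof. by move=> aA aB w w' E [Aw Bw]; split; [exact: aA Aw|exact: aB Bw]. Qed.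

Lemma adaptedS m n A : (m <= n)%N -> adapted m A -> adapted n A.
Proof.
by move=> mn aA w w' E; apply: aA => i im; apply: E; exact: leq_trans mn.
Qed.

Definition cylinder n (s : nat -> V) := [set w | forall i, (i <= n)%N -> Z i w = s i].

Lemma measurable_cylinder n s : measurable (cylinder n s).
Proof.
rewrite (_ : cylinder n s = \bigcap_(i < n.+1) [set w | Z i w = s i]).
  by apply: bigcap_measurable => [|i _]; [exists 0%N|exact: measurable_at].
by apply/seteqP; split => w E i; exact: E.
Qed.

Lemma adapted_atoms n A : adapted n A -> exists F : (set T)^nat,
  [/\ trivIset setT F, A = \bigcup_k F k
    & forall k, F k = set0 \/ exists2 w, A w & F k = cylinder n (Z^~ w)].
Proof.
move=> aA; have [f finj] := countable_injP _ countV.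
(* Histories up to time [n] are coded by natural numbers; the nonempty fibres of [code] in [A] are
   cylinders. *)
pose code w := choice.pickle [seq f (Z i w) | i <- iota 0 n.+1].
have codeP w w' : code w = code w' -> forall i, (i <= n)%N -> Z i w = Z i w'.
  move=> /(pcan_inj choice.pickleK)/(congr1 (nth 0%N ^~ _)) E i ni.
  have := E i; rewrite !(nth_map 0%N) ?size_iota// !nth_iota// add0n => fE.
  by apply: finj; rewrite ?in_setT.
have codeE w w' : (forall i, (i <= n)%N -> Z i w = Z i w') -> code w = code w'.
  move=> E; congr choice.pickle; apply/eq_in_map => i.
  by rewrite mem_iota add0n => /andP[_ ni]; rewrite E.
exists (fun k => A `&` [set w | code w = k]); split.
- by move=> i j _ _ [w [[_ /= <-] [_ /= <-]]].
- by apply/seteqP; split => [w Aw|w [k _ []//]]; exists (code w).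
move=> k; have [[w [Aw wk]]|no] := pselect (exists w, A w /\ code w = k).
  right; exists w => //; apply/seteqP; split => w' /=.
    by move=> [_ w'k]; apply: codeP; rewrite w'k wk.
  move=> E; split; first by apply: aA Aw => i ni; rewrite E.
  by rewrite -wk; apply: codeE.
left; apply/seteqP; split => // w [Aw wk]; by case: no; exists w.
Qed.

Lemma adapted_measurable n A : adapted n A -> measurable A.
Proof.
move=> /adapted_atoms[F [_ -> FE]]; apply: bigcupT_measurable => k.
by case: (FE k) => [->//|[w _ ->]]; exact: measurable_cylinder.
Qed.

Lemma adapted_step n A y z : adapted n A ->
  pr (A `&` [set w | Z n w = y] `&` [set w | Z n.+1 w = z])
  = pr (A `&` [set w | Z n w = y]) * q y z.
Proof.
move=> aA; have aAy := adaptedI aA (@adapted_at n y).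
have mAy := adapted_measurable aAy.
have [F [tF AE FE]] := adapted_atoms aAy.
have mF k : measurable (F k).
  by case: (FE k) => [->//|[w _ ->]]; exact: measurable_cylinder.
have mFz k : measurable (F k `&` [set w | Z n.+1 w = z]).
  by apply: measurableI => //; exact: measurable_at.
have tFz : trivIset setT (fun k => F k `&` [set w | Z n.+1 w = z]).
  by apply: trivIset_setIr.
have FzE k : pr (F k `&` [set w | Z n.+1 w = z]) = pr (F k) * q y z.
  case: (FE k) => [->|[w [_ /= wy] FkE]]; first by rewrite set0I /pr measure0 mul0r.
  (* The history of [w] up to time [n], continued by [z]. *)
  pose s i := if i == n.+1 then z else Z i w.
  have cE : cylinder n (Z^~ w) = cylinder n s.
    apply/seteqP; split => w' E i ni; have := E i ni;
    by rewrite /s ltn_eqF// ltnS.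
  rewrite FkE cE.
  have [_ _ /(_ n s)] := chainZ.
  rewrite /s eqxx ltn_eqF//= -/s wy => E.
  rewrite (_ : _ `&` _ = cylinder n.+1 s).
    apply: EFin_inj; rewrite EFinM -!prE//; exact: measurable_cylinder.
  apply/seteqP; split => w' /=.
    move=> [E1 E2] i; rewrite leq_eqVlt => /orP[/eqP->|]; last exact: E1.
    by rewrite E2 /s eqxx.
  move=> E1; split => [i ni|]; first by apply: E1; exact: leqW.
  by rewrite E1// /s eqxx.
rewrite {1}AE setI_bigcupl.
have C1 := cvg_series_pr P mFz tFz.
have C2 := cvg_series_pr P mF tF.
apply: (cvgn_unique C1); rewrite AE.
have -> : series (fun k => pr (F k `&` [set w | Z n.+1 w = z]))
   = fun k => series (fun k => pr (F k)) k * q y z.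
  by apply/funext => k; rewrite /series /= mulr_suml; apply: eq_bigr => i _.
exact: cvgMl.
Qed.

End ChainHistory.

(** * Escape from a finite set *)

Section NearestNeighbourChain.
Context {R : realType} {V : choiceType} (N : network R V).
Context {d : measure_display} {T : measurableType d}.
Variable P : probability T R.
Variables (mu : V -> R) (q : V -> V -> R) (Z : nat -> T -> V).
Hypothesis chainZ : markov_chain P mu q Z.
Hypothesis q_ge0 : forall y z, 0 <= q y z.
Hypothesis q_nonadj : forall y z, ~~ adj N y z -> q y z = 0.
Hypothesis q_sum_le1 : forall y, \sum_(z <- nb N y) q y z <= 1.
Local Notation pr := (rprob P).
Local Notation countV := (countable_vertices N).
Local Notation adapted := (adapted Z).

Let meas := measurable_chain chainZ.
Let meas_at := measurable_at chainZ.
Let adm := adapted_measurable N chainZ.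

(** [A] may depend on the future, as the avoidance events below do; dropping it leaves a step of
    weight 0. *)
Lemma pr_nonadj (A : set T) n y z : measurable A -> ~~ adj N y z ->
  pr (A `&` [set w | Z n w = y] `&` [set w | Z n.+1 w = z]) = 0.
Proof.
move=> mA yz; apply/eqP; rewrite eq_le pr_ge0 andbT.
have := adapted_step N chainZ y z (@adaptedT _ _ _ Z n).
rewrite q_nonadj// mulr0 setTI => <-.
apply: le_pr; do ?by apply: measurableI => //; exact: meas_at.
  by apply: measurableI; [apply: measurableI|] => //; exact: meas_at.
by move=> w [[_]].
Qed.

Lemma pr_next (A : set T) n y : measurable A ->
  pr (A `&` [set w | Z n w = y])
  = \sum_(z <- nb N y) pr (A `&` [set w | Z n w = y] `&` [set w | Z n.+1 w = z]).
Proof.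
move=> mA; apply: (pr_sum_seq (P := P) countV).
- exact: meas.
- by apply: measurableI => //; exact: meas_at.
- exact: nb_uniq.
- by move=> z; rewrite mem_nb; exact: pr_nonadj.
Qed.

Lemma adapted_next (A : set T) n z : adapted n A ->
  pr (A `&` [set w | Z n.+1 w = z])
  = \sum_(y <- nb N z) pr (A `&` [set w | Z n w = y]) * q y z.
Proof.
move=> aA; have mA := adm aA.
have mAz : measurable (A `&` [set w | Z n.+1 w = z]).
  by apply: measurableI => //; exact: meas_at.
rewrite (pr_sum_seq (P := P) countV (meas n) mAz (nb_uniq N z)).
  by apply: eq_bigr => y _; rewrite setIAC (adapted_step N chainZ).
move=> y; rewrite mem_nb adj_sym setIAC; exact: pr_nonadj.
Qed.

Variable K : seq V.

(** The starting vertex is not tested, since at its last exit from [K] the chain is in [K]. *)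
Fixpoint avoid_prob (m : nat) (y : V) : R :=
  if m is m'.+1 then \sum_(z <- nb N y) q y z * (z \notin K)%:R * avoid_prob m' z
  else 1.

Definition avoids n m : set T :=
  [set w | forall i, (n < i)%N -> (i <= n + m)%N -> Z i w \notin K].

Lemma measurable_avoids n m : measurable (avoids n m).
Proof.
rewrite (_ : avoids n m =
    \bigcap_i (if (n < i <= n + m)%N then Z i @^-1` [set v | v \notin K] else setT)).
  by apply: bigcapT_measurable => i; case: ifP => // _; exact: meas.
apply/seteqP; split => [w E i _|w E i ni im].
  by case: ifP => // /andP[ni im]; exact: E.
by have := E i Logic.I; rewrite ni im.
Qed.

Lemma pr_avoids m n (A : set T) y : adapted n A ->
  pr (A `&` [set w | Z n w = y] `&` avoids n m)
  = pr (A `&` [set w | Z n w = y]) * avoid_prob m y.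
Proof.
elim: m n A y => [|m IH] n A y aA /=.
  rewrite mulr1; congr pr; apply/seteqP; split => [w []//|w Aw]; split => // i.
  by rewrite addn0 => /leq_trans h /h; rewrite ltnn.
have mA := adm aA; have aAy := adaptedI aA (@adapted_at _ _ _ Z n y).
rewrite setIAC pr_next; last first.
  by apply: measurableI => //; exact: measurable_avoids.
rewrite mulr_sumr; apply: eq_bigr => z _.
have [zK|zK] /= := boolP (z \in K).
  rewrite mulr0 mul0r mulr0 (_ : _ `&` _ = set0) ?pr0//.
  apply/seteqP; split => // w [[[_ av] _] /= wz].
  by have := av n.+1 (leqnn _); rewrite wz zK addnS ltnS leq_addr => /(_ isT).
rewrite mulr1 mulrA -(adapted_step N chainZ)// -IH; last exact: adaptedS aAy.
congr pr; apply/seteqP; split => w /=.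
  move=> [[[Aw av] wy] wz]; split; first by [].
  by move=> i ni im; apply: (av i (ltnW ni)); rewrite addnS -addSn.
move=> [[[Aw wy] wz] av]; split; last by [].
split; last by [].
split; first by [].
move=> i; rewrite leq_eqVlt => /orP[/eqP <- _|ni]; first by rewrite wz.
by rewrite addnS -addSn; exact: av.
Qed.

Lemma avoid_prob_ge0 m y : 0 <= avoid_prob m y.
Proof.
elim: m y => //= m IH y; apply: sumr_ge0 => z _.
by rewrite !mulr_ge0.
Qed.

Lemma avoid_prob_le m y : avoid_prob m.+1 y <= avoid_prob m y.
Proof.
elim: m y => [|m IH] y /=.
  apply: le_trans (q_sum_le1 y); apply: ler_sum => z _.
  by rewrite mulr1 ler_piMr// lern1 leq_b1.
by apply: ler_sum => z _; apply: ler_wpM2l; [rewrite mulr_ge0|exact: IH].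
Qed.

Definition never_prob (y : V) : R := limn (avoid_prob^~ y).

Lemma cvg_avoid_prob y : avoid_prob^~ y @ \oo --> never_prob y.
Proof.
apply: nonincreasing_is_cvgn.
  by apply/nonincreasing_seqP => m; exact: avoid_prob_le.
by exists 0 => _ [m _ <-]; exact: avoid_prob_ge0.
Qed.

Lemma never_prob_ge0 y : 0 <= never_prob y.
Proof.
apply: limr_ge; first exact: cvg_avoid_prob.
by near=> m; exact: avoid_prob_ge0.
Unshelve. all: by end_near. Qed.

Definition never_after n : set T := [set w | forall i, (n < i)%N -> Z i w \notin K].

Lemma measurable_never_after n : measurable (never_after n).
Proof.
rewrite (_ : never_after n = \bigcap_m avoids n m).
  by apply: bigcapT_measurable => m; exact: measurable_avoids.
apply/seteqP; split => [w E m _ i ni _|w E i ni]; first exact: E.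
by apply: (E (i - n)%N) => //; rewrite subnKC// ltnW.
Qed.

(** The future event is a decreasing limit of finite windows, so the Markov property for finite
    trajectories suffices. The factor depends on [y] and not on [n], which allows summing over last
    exit times. *)
Lemma pr_never_after n (A : set T) y : adapted n A ->
  pr (A `&` [set w | Z n w = y] `&` never_after n)
  = pr (A `&` [set w | Z n w = y]) * never_prob y.
Proof.
move=> aA; have mAy := adm (adaptedI aA (@adapted_at _ _ _ Z n y)).
pose F m := A `&` [set w | Z n w = y] `&` avoids n m.
have FE : A `&` [set w | Z n w = y] `&` never_after n = \bigcap_m F m.
  apply/seteqP; split => w.
    by move=> [Aw E] m _; split => // i ni _; exact: E.
  move=> E; split; first by have [] := E 0%N Logic.I.
  by move=> i ni; have [_] := E (i - n)%N Logic.I; apply; rewrite ?subnKC// ltnW.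
have mF m : measurable (F m) by apply: measurableI => //; exact: measurable_avoids.
have niF : nonincreasing_seq F.
  move=> m m' mm'; apply/subsetPset => w [Aw E]; split => // i ni im; apply: E => //.
  by apply: leq_trans im _; rewrite leq_add2l.
have := cvg_pr_bigcap P mF niF; rewrite -FE => C; apply: (cvgn_unique C).
rewrite (_ : (fun m => _) = (fun m => pr (A `&` [set w | Z n w = y]) * avoid_prob m y)).
  by apply: cvgMr; exact: cvg_avoid_prob.
by apply/funext => m; rewrite -pr_avoids.
Qed.

End NearestNeighbourChain.

(** * The recurrent walk *)

Section Recurrence.
Context {R : realType} {V : choiceType} (N : network R V) (o : V).
Context {d : measure_display} {W : measurableType d}.
Variables (PW : V -> probability W R) (X : nat -> W -> V).
Hypothesis walkX : network_walk N PW X.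
Hypothesis recX : recurrent_walk PW X.

Local Notation c := (total_cond N).
Local Notation p := (walk_trans N).
Local Notation Q := (iter_killed N o).
Local Notation kk := (green_term N o).

Lemma iter_alive_avoid m y : Q m (alive o) y = (y != o)%:R * avoid_prob N p [:: o] m y.
Proof.
elim: m y => [|m IH] y /=; first by rewrite mulr1.
have [->|yo] := eqVneq y o; first by rewrite killedo mul0r.
rewrite killedE// mul1r; apply: eq_bigr => z _.
by rewrite IH inE mulrA.
Qed.

Lemma cvg0_dominated (a : R) (u v : R^nat) : 0 < a ->
  (forall n, 0 <= u n) -> (forall n, a * u n <= v n) ->
  v @ \oo --> (0 : R) -> u @ \oo --> (0 : R).
Proof.
move=> a0 u0 uv v0.
apply: (@squeeze_cvgr _ _ _ _ (fun=> 0) (fun n => a^-1 * v n)).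
- by near=> n; rewrite u0 /= mulrC ler_pdivlMr// mulrC.
- exact: cvg_cst.
- by rewrite -[X in _ --> X](mulr0 a^-1); apply: cvgMr.
Unshelve. all: by end_near. Qed.

(** The limit is the probability that the walk from [o] never returns. *)
Lemma cvg_avoid_root : avoid_prob N p [:: o] ^~ o @ \oo --> (0 : R).
Proof.
have chainX := walkX o.
have q0 := walk_trans_ge0 N; have qn := @walk_trans_nonadj _ _ N.
have q1 : forall y, \sum_(z <- nb N y) p y z <= 1.
  by move=> y; rewrite walk_trans_sum1.
have := pr_never_after chainX q0 qn q1 [:: o] o (@adaptedT _ _ _ X 0).
have [mX X0 _] := chainX.
have X0o : rprob (PW o) [set w | X 0%N w = o] = 1.
  by rewrite /rprob X0 eqxx.
rewrite setTI X0o mul1r => E.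
have <- : never_prob N p [:: o] o = 0; last exact: cvg_avoid_prob.
rewrite -E; apply: pr_eq0.
  by apply: measurableI; [exact: (mX 0%N [set o])|exact: (measurable_never_after chainX)].
have mR : measurable [set w | exists n, (0 < n)%N /\ X n w = o].
  rewrite (_ : [set w | _] = \bigcup_(n in [set n | (0 < n)%N]) (X n @^-1` [set o])).
    by apply: bigcup_measurable.
  by apply/seteqP; split => [w [n [n0 Xn]]|w [n n0 Xn]]; exists n.
exists (~` [set w | exists n, (0 < n)%N /\ X n w = o]); split.
- exact: measurableC.
- by rewrite probability_setC// (recX o) subee.
- by move=> w [_ /= nv] [n [n0 Xn]]; have := nv n n0; rewrite Xn inE eqxx.
Qed.

Lemma cvg_iter_alive y : Q n (alive o) y @[n --> \oo] --> (0 : R).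
Proof.
have Q0 n z : 0 <= Q n (alive o) z.
  by apply: iter_killed_ge0 => *; exact: alive_ge0.
apply: (@connected_ind _ _ N (fun y => Q n (alive o) y @[n --> \oo] --> (0 : R)) o).
  rewrite (_ : (fun n => _) = fun=> 0); first exact: cvg_cst.
  by apply/funext => n; rewrite iter_killedo// aliveo.
move=> {}y z yz; have [->|zo] := eqVneq z o.
  move=> _; rewrite (_ : (fun n => _) = fun=> 0); first exact: cvg_cst.
  by apply/funext => n; rewrite iter_killedo// aliveo.
have zy : z \in nb N y by rewrite mem_nb.
(* [Q n (alive o)] vanishes at [o], so it gives no control along an edge leaving [o]; there the
   non-return probability of [o] takes its place. *)
have [yo|yo] := eqVneq y o => Qy.
  apply: (@cvg0_dominated (p y z) _ (fun n => avoid_prob N p [:: o] n.+1 y)) => //.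
  - exact: walk_trans_gt0.
  - move=> n /=; rewrite (big_rem z)//= inE zo mulr1 iter_alive_avoid zo mul1r.
    rewrite lerDl sumr_ge0// => t _; apply: mulr_ge0.
      by rewrite mulr_ge0// walk_trans_ge0.
    exact/avoid_prob_ge0/walk_trans_ge0.
  - by rewrite (cvg_shiftS (avoid_prob N p [:: o] ^~ y)) yo; exact: cvg_avoid_root.
apply: (@cvg0_dominated (p y z) _ (fun n => Q n.+1 (alive o) y)) => //.
- exact: walk_trans_gt0.
- move=> n; rewrite iter_killedS killedE// (big_rem z)//= lerDl sumr_ge0// => t _.
  by rewrite mulr_ge0// walk_trans_ge0.
- by rewrite (cvg_shiftS (fun n => Q n (alive o) y)).
Qed.

Definition not_hit n : set W := [set w | forall i, (i <= n)%N -> X i w <> o].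

Lemma adapted_not_hit n : adapted X n (not_hit n).
Proof. by move=> w w' E nw i ni; rewrite -E//; exact: nw. Qed.

Lemma lt_hitting_time n w :
  (n%:R%:E < hitting_time (R := R) X o w)%E <-> not_hit n w.
Proof.
split=> [nlt i ni Xi|nh].
  move: nlt; apply/negP; rewrite -leNgt; apply: ge_ereal_inf.
  by exists i%:R%:E; [exists i|rewrite lee_fin ler_nat].
apply: (@lt_le_trans _ _ n.+1%:R%:E); first by rewrite lte_fin ltr_nat.
apply: le_ereal_inf_tmp => _ [m /= Xm <-]; rewrite lee_fin ler_nat ltnNge.
by apply/negP => mn; exact: (nh m).
Qed.

(** Detailed balance [c_y p(y, z) = c_z p(z, y)] turns the iteration from the end point [y] into the
    law of the walk started at [x]. *)
Lemma pr_killed_walk n x y : y != o ->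
  rprob (PW x) (not_hit n `&` [set w | X n w = y]) = c y * kk n x y.
Proof.
have chainX := walkX x; have [mX X0 _] := chainX.
elim: n y => [|n IH] y yo.
  rewrite /kk /= yo andbT (_ : _ `&` _ = [set w | X 0%N w = y]).
    rewrite /rprob X0 /=; case: eqVneq => [->|_]; last by rewrite mul0r mulr0.
    by rewrite mulrCA divff ?mulr1// total_cond_neq0.
  apply/seteqP; split => [w []//|w /= Xy]; split => // i; rewrite leqn0 => /eqP->.
  by rewrite Xy; apply/eqP.
have -> : not_hit n.+1 `&` [set w | X n.+1 w = y]
        = not_hit n `&` [set w | X n.+1 w = y].
  apply/seteqP; split => w [nh Xy]; split => // i; first by move=> ni; apply: nh; exact: leqW.
  rewrite leq_eqVlt => /orP[/eqP->|]; last exact: nh.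
  by rewrite Xy; apply/eqP.
rewrite (adapted_next chainX (@walk_trans_nonadj _ _ N))//; last exact: adapted_not_hit.
rewrite -[kk n.+1 x]/(killed N o (kk n x)) killedE// mulr_sumr.
apply: eq_bigr => z _; rewrite [RHS]mulrA total_condM cond_sym -total_condM.
have [->|zo] := eqVneq z o; last by rewrite IH// mulrAC.
rewrite green_termo mulr0 (_ : _ `&` _ = set0) ?pr0 ?mul0r//.
by apply/seteqP; split => // w [/(_ n (leqnn n))].
Qed.

Lemma green_densityE x y : y != o ->
  green_density N PW X o x y = (green N o x y)%:E.
Proof.
move=> yo; rewrite /green_density.
have PE n : PW x [set w | X n w = y /\ (n%:R%:E < hitting_time (R := R) X o w)%E]
    = (c y * kk n x y)%:E.
  rewrite -(pr_killed_walk n x yo) -prE.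
    congr (PW x _); apply/seteqP; split => w.
      by move=> [Xy /lt_hitting_time nh].
    by move=> [/lt_hitting_time nh Xy].
  apply: measurableI; first exact: (adapted_measurable N (walkX x) (@adapted_not_hit n)).
  exact: measurable_at (walkX x) _ _.
have -> : (\sum_(0 <= n <oo)
     PW x [set w | X n w = y /\ (n%:R%:E < hitting_time (R := R) X o w)%E]
   = (c y * green N o x y)%:E)%E.
  apply: cvg_lim => //.
  rewrite (_ : (fun n => _) = EFin \o (fun n => c y * series (fun n => kk n x y) n)).
    apply: cvg_EFin; first by near=> n.
    by apply: cvgMr; exact: (cvg_green cvg_iter_alive).
  apply/funext => n /=; rewrite /series /= mulr_sumr -sumEFin.
  by apply: eq_bigr => k _; rewrite PE.
by rewrite -EFinM mulrA mulVf ?mul1r// total_cond_neq0.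
Unshelve. all: by end_near. Qed.

End Recurrence.

(** * Last exits of the h-process *)

(** Forgets the subtype, so that the chain can be compared with the walk on all of [V]. *)
Lemma val_doob_chain {R : realType} {V : choiceType} (N : network R V) (o : V)
    (h : V -> R) {d : measure_display} {T : measurableType d}
    (P : probability T R) (Y : nat -> T -> hstates h) :
  potential N o h -> markov_chain P (hinit N o h) (htrans N h) Y ->
  markov_chain P (fun v => cond N o v * h v) (doob_trans N h)
    (fun n w => val (Y n w)).
Proof.
move=> pot_h [mY Y0 YS].
have Ypos n w : 0 < h (val (Y n w)) by have := set_valP (Y n w).
split.
- by move=> n A; have := mY n (val @^-1` A).
- move=> x; have [hx|hx] := ltP 0 (h x).
    pose x' : hstates h := exist _ x (mem_set hx).
    rewrite -[RHS](Y0 x'); congr (P _); apply/seteqP; split => w /=.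
      by move=> E; apply: val_inj.
    by move=> ->.
  have -> : h x = 0 by apply/eqP; rewrite eq_le hx (potential_ge0 pot_h).
  rewrite mulr0 (_ : [set w | _] = set0) ?measure0//.
  by apply/seteqP; split => // w E; have := Ypos 0%N w; rewrite (E : val (Y 0%N w) = x) ltNge hx.
move=> n s.
have [spos|] := pselect (forall i, (i <= n.+1)%N -> 0 < h (s i)).
  pose x0 : hstates h := exist _ (s 0%N) (mem_set (spos 0%N (leq0n _))).
  pose s' i := insubd x0 (s i).
  have vs i : (i <= n.+1)%N -> val (s' i) = s i.
    by move=> ni; rewrite insubdK//; apply/mem_set/spos.
  have := YS n s'; rewrite /htrans !vs// => E.
  have VE m : (m <= n.+1)%N ->
      [set w | forall i, (i <= m)%N -> val (Y i w) = s i]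
      = [set w | forall i, (i <= m)%N -> Y i w = s' i].
    move=> mn; apply/seteqP; split => w /= H i im.
      by apply: val_inj; rewrite vs ?(leq_trans im)//; exact: H.
    by rewrite H// vs// (leq_trans im).
  by rewrite !VE.
move=> /existsNP[i /not_implyP[ni /negP]]; rewrite -leNgt => hsi.
rewrite [X in P X](_ : _ = set0); last first.
  by apply/seteqP; split => // w H; have := Ypos i w; rewrite (H i ni : val (Y i w) = s i) ltNge hsi.
(* If [h] vanishes at the last vertex, the factor [doob_trans] is 0; if at an earlier one, the
   history is already impossible. *)
rewrite measure0; move: ni; rewrite leq_eqVlt => /orP[/eqP E|ni].
  have h0 : h (s n.+1) = 0.
    by apply/eqP; rewrite eq_le -{1}E hsi (potential_ge0 pot_h).
  by rewrite /doob_trans h0 mulr0 mul0r mule0.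
rewrite [X in P X](_ : _ = set0) ?measure0 ?mul0e//.
by apply/seteqP; split => // w H; have := Ypos i w; rewrite (H i ni : val (Y i w) = s i) ltNge hsi.
Qed.

Lemma pr_sum_disjoint {R : realType} {d : measure_display} {T : measurableType d}
    (P : probability T R) (I : eqType) (s : seq I) (F : I -> set T) :
  uniq s -> (forall i, measurable (F i)) ->
  (forall i j, i \in s -> j \in s -> i != j -> F i `&` F j = set0) ->
  measurable [set w | exists2 i, i \in s & F i w] /\
  rprob P [set w | exists2 i, i \in s & F i w] = \sum_(i <- s) rprob P (F i).
Proof.
move=> us mF dF; elim: s us dF => [_ _|i s IH /= /andP[ins us] dF].
  by rewrite (_ : [set w | _] = set0) ?big_nil ?pr0//; apply/seteqP; split=> // w [].
have [|mS IHE] := IH us.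
  by move=> j k js ks; apply: dF; rewrite in_cons ?js ?ks orbT.
have E : [set w | exists2 j, j \in i :: s & F j w]
       = F i `|` [set w | exists2 j, j \in s & F j w].
  apply/seteqP; split => w /=.
    by move=> [j]; rewrite in_cons => /orP[/eqP ->|js] Fj; [left|right; exists j].
  by move=> [Fi|[j js Fj]]; [exists i|exists j]; rewrite ?mem_head// in_cons js orbT.
rewrite E; split; first exact: measurableU.
rewrite prU//; first by rewrite big_cons IHE.
apply/seteqP; split => // w [Fi [j js Fj]].
rewrite -(dF i j) ?mem_head ?in_cons ?js ?orbT//.
by apply: contraNneq ins => ->.
Qed.

Section HProcess.
Context {R : realType} {V : choiceType} (N : network R V) (o : V) (h : V -> R).
Context {d : measure_display} {T : measurableType d}.
Variables (P : probability T R) (Z : nat -> T -> V).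

Local Notation c := (total_cond N).
Local Notation p := (walk_trans N).
Local Notation Q := (iter_killed N o).
Local Notation r := (exit_prob N o).
Local Notation kk := (green_term N o).
Local Notation q := (doob_trans N h).
Local Notation pr := (rprob P).
Local Notation adapted := (adapted Z).

Hypothesis alive_cvg0 : forall y, Q n (alive o) y @[n --> \oo] --> (0 : R).
Hypothesis pot_h : potential N o h.
Hypothesis chainZ : markov_chain P (fun v => cond N o v * h v) q Z.

Let q_ge0 := doob_trans_ge0 pot_h.
Let q_nonadj := @doob_trans_nonadj _ _ N h.
Let q_sum := sum_doob_trans_le1 pot_h.
Let adm n A := @adapted_measurable _ _ N _ _ _ _ _ _ chainZ n A.

Lemma pr_doob_step n k A f z : adapted n A -> f o = 0 ->
  (forall y, pr (A `&` [set w | Z n w = y]) = c y * h y * f y) ->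
  pr (A `&` [set w | Z (n + k)%N w = z]) = c z * h z * Q k f z.
Proof.
move=> aA fo Af; elim: k z => [|k IH] z; first by rewrite addn0.
rewrite addnS (adapted_next chainZ q_nonadj); last first.
  exact: adaptedS (leq_addr _ _) aA.
rewrite iter_killedS -doob_reversal//; last exact: iter_killedo.
by apply: eq_bigr => y _; rewrite IH.
Qed.

(** The initial law [c_ov h(v) = c_v h(v) p(v, o)] has density [r]. Read backwards, the first [n]
    steps followed by a step to [o] are a killed walk from [y] dying at time [n + 1]. *)
Lemma pr_doob n y : pr [set w | Z n w = y] = c y * h y * Q n r y.
Proof.
rewrite -[LHS]/(pr [set w | Z (0 + n)%N w = y]) -[X in pr X]setTI.
apply: pr_doob_step => //; first exact: exit_probo.
move=> {}y; rewrite setTI; have [_ Z0 _] := chainZ.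
rewrite {1}/rprob Z0 /= /exit_prob.
case: eqVneq => [->|yo]; first by rewrite (potentialo pot_h) mulr0 mulr0.
by rewrite mulrAC total_condM cond_sym.
Qed.

Lemma cvg_series_pr_doob y :
  series (fun n => pr [set w | Z n w = y]) @ \oo --> c y * h y.
Proof.
have -> : series (fun n => pr [set w | Z n w = y])
    = fun n => c y * h y * series (fun n => Q n r y) n.
  apply/funext => n; rewrite /series /= mulr_sumr.
  by apply: eq_bigr => k _; rewrite pr_doob.
have E : c y * h y = c y * h y * alive o y.
  rewrite /alive; case: eqVneq => [->|_]; last by rewrite mulr1.
  by rewrite (potentialo pot_h) !(mulr0, mul0r).
by rewrite [X in _ --> X]E; apply: cvgMr; exact: (cvg_series_exit alive_cvg0).
Qed.

Definition transient_paths : set T :=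
  [set w | forall K : seq V, exists n, forall m, (n <= m)%N -> Z m w \notin K].

(** Borel-Cantelli: the expected number of visits to [v] is [c v * h v], hence finite. *)
Lemma negligible_recurrent_paths : P.-negligible (~` transient_paths).
Proof.
have [f finj] := countable_injP _ (countable_vertices N).
pose F k := \bigcup_(v in [set v | f v = k]) lim_sup_set (fun n => [set w | Z n w = v]).
apply: (@negligibleS _ _ _ P (\bigcup_k F k)).
  move=> w nw; apply: contrapT => nF; apply: nw.
  elim=> [|v K [n Hn]]; first by exists 0%N.
  suff [m Hm] : exists m, forall m', (m <= m')%N -> Z m' w <> v.
    exists (maxn n m) => m' mm'; rewrite in_cons negb_or Hn ?andbT.
      by apply/eqP/Hm; exact: leq_trans (leq_maxr _ _) mm'.
    exact: leq_trans (leq_maxl _ _) mm'.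
  apply: contrapT => io; apply: nF; exists (f v) => //; exists v => //= n' _.
  apply: contrapT => no; apply: io; exists n' => m' nm' Zv; apply: no.
  by exists m'.
apply: negligible_bigcup => k.
have [[v fv]|no] := pselect (exists v, f v = k).
  have mFv n : measurable [set w | Z n w = v] by exact: measurable_at chainZ _ _.
  apply: (@negligibleS _ _ _ P (lim_sup_set (fun n => [set w | Z n w = v]))).
    move=> w [v' /= fv']; suff -> : v' = v by [].
    by apply: finj; rewrite ?in_setT// fv fv'.
  apply/negligibleP.
    apply: bigcapT_measurable => n; exact: bigcup_measurable.
  apply: lim_sup_set_cvg0 => //.
  rewrite (_ : limn _ = (c v * h v)%:E) ?ltry//; apply: cvg_lim => //.
  rewrite (_ : (fun n => _) = EFin \o series (fun n => pr [set w | Z n w = v])).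
    apply: cvg_EFin; first by near=> n.
    exact: cvg_series_pr_doob.
  apply/funext => n /=; rewrite /series /= -sumEFin.
  by apply: eq_bigr => i _; rewrite -prE.
apply: (@negligibleS _ _ _ P set0); last exact: negligible_set0.
by move=> w [v fv]; case: no; exists v.
Unshelve. all: by end_near. Qed.

Section LastExit.
Variable K : seq V.
Local Notation nv := (never_prob N q K).
Local Notation NA := (never_after Z K).

Lemma last_exit_exists n w : transient_paths w -> Z n w \in K ->
  exists k, Z (n + k)%N w \in K /\ NA (n + k)%N w.
Proof.
move=> /(_ K)[M HM] ZnK.
have ex : exists k, Z (n + k)%N w \in K by exists 0%N; rewrite addn0.
have bd k : Z (n + k)%N w \in K -> (k <= M)%N.
  move=> Zk; rewrite leqNgt; apply/negP => Mk.
  by have := HM (n + k)%N (leq_trans (ltnW Mk) (leq_addl _ _)); rewrite Zk.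
have [k Zk kmax] := ex_maxnP ex bd; exists k; split => // i nki.
apply/negP => Zi; have ni : (n <= i)%N by apply: leq_trans (ltnW nki); exact: leq_addr.
have := kmax (i - n)%N; rewrite subnKC// => /(_ Zi).
by rewrite leq_subLR leqNgt nki.
Qed.

(** [E k] is a condition on the past at the possible exit time [n + k]. The offset [n] serves events
    such as [Z n = x], which are adapted from time [n] on. *)
Definition last_exit n (E : (set T)^nat) (y : V) : set T :=
  \bigcup_k (E k `&` [set w | Z (n + k)%N w = y] `&` NA (n + k)%N).

Lemma last_exit_time_unique i j w :
  Z i w \in K -> Z j w \in K -> NA i w -> NA j w -> i = j.
Proof.
move=> Zi Zj Ni Nj; case: (ltngtP i j) => // [ij|ji].
- by have := Ni _ ij; rewrite Zj.
- by have := Nj _ ji; rewrite Zi.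
Qed.

Lemma measurable_last_exit n E y :
  (forall k, adapted (n + k)%N (E k)) -> measurable (last_exit n E y).
Proof.
move=> aE; apply: bigcupT_measurable => k.
apply: measurableI; last exact: measurable_never_after chainZ _ _.
apply: measurableI; [exact: adm (aE k)|exact: measurable_at chainZ _ _].
Qed.

Lemma pr_last_exit n E y (l : R) : y \in K -> (forall k, adapted (n + k)%N (E k)) ->
  series (fun k => pr (E k `&` [set w | Z (n + k)%N w = y])) @ \oo --> l ->
  pr (last_exit n E y) = l * nv y.
Proof.
move=> yK aE El.
have mF k : measurable (E k `&` [set w | Z (n + k)%N w = y] `&` NA (n + k)%N).
  apply: measurableI; last exact: measurable_never_after chainZ _ _.
  apply: measurableI; [exact: adm (aE k)|exact: measurable_at chainZ _ _].
have tF : trivIset setT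
    (fun k => E k `&` [set w | Z (n + k)%N w = y] `&` NA (n + k)%N).
  move=> i j _ _ [w [[[_ /= Zi] Ni] [[_ /= Zj] Nj]]].
  apply/eqP; rewrite -(eqn_add2l n); apply/eqP.
  by apply: last_exit_time_unique Ni Nj; rewrite ?Zi ?Zj.
apply: (cvgn_unique (cvg_series_pr P mF tF)).
rewrite (_ : series _ =
  fun m => series (fun k => pr (E k `&` [set w | Z (n + k)%N w = y])) m * nv y).
  exact: cvgMl.
apply/funext => m; rewrite /series /= mulr_suml; apply: eq_bigr => k _.
have -> // := pr_never_after chainZ q_ge0 q_nonadj q_sum K y (aE k).
Qed.

Lemma last_exit_disjoint n E y y' : y \in K -> y' \in K -> y != y' ->
  last_exit n E y `&` last_exit n E y' = set0.
Proof.
move=> yK y'K yy'; apply/seteqP; split => // w [[k _ [[_ /= Zk] Nk]] [j _ [[_ /= Zj] Nj]]].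
have E1 : (n + k)%N = (n + j)%N.
  by apply: last_exit_time_unique Nk Nj; rewrite ?Zk ?Zj.
by move/eqP: yy'; apply; rewrite -Zk -Zj E1.
Qed.

Hypothesis uK : uniq K.

Lemma pr_last_exitT y : y \in K ->
  pr (last_exit 0 (fun=> setT) y) = c y * h y * nv y.
Proof.
move=> yK; apply: pr_last_exit => //.
under [X in series X]eq_fun do rewrite setTI.
exact: cvg_series_pr_doob.
Qed.

(** The terms are the probabilities of the possible last-exit positions; [K] may also never be
    visited, whence an inequality. *)
Lemma sum_never_prob_le1 : \sum_(y <- K) c y * h y * nv y <= 1.
Proof.
have [mU EU] := pr_sum_disjoint P uK
  (fun y => @measurable_last_exit 0 (fun=> setT) y (fun k => @adaptedT _ _ _ Z _))
  (@last_exit_disjoint 0 (fun=> setT)).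
rewrite big_seq; under eq_bigr => y yK do rewrite -(pr_last_exitT yK).
by rewrite -big_seq -EU; exact: pr_le1.
Qed.

(* Evaluates [P (Z n = x)] by the position of [Z] at its last exit from [K]. *)
Lemma green_last_exit x : x \in K -> 0 < h x ->
  \sum_(y <- K) green N o x y * (c y * h y * nv y) = h x.
Proof.
move=> xK hx.
have xo : x != o by apply: contraTneq hx => ->; rewrite (potentialo pot_h) ltxx.
have [n Qn] := exit_gt0 alive_cvg0 xo.
set A := [set w | Z n w = x].
have aA k : adapted (n + k)%N A by apply: adaptedS (leq_addr _ _) _; exact: adapted_at.
have A0 : 0 < pr A by rewrite pr_doob !mulr_gt0 ?total_cond_gt0.
(* On [A] the law of [Z n] is a point mass at [x], of density [pr A / (c x * h x)]; the factor
   [pr A] cancels at the end. *)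
have Ak k y : pr (A `&` [set w | Z (n + k)%N w = y])
    = c y * h y * (pr A / h x * kk k x y).
  rewrite -iter_killedZ; apply: pr_doob_step => //.
  - exact: adapted_at.
  - by rewrite eqxx andbF mul0r mulr0.
  move=> {}y; case: eqVneq => [->|yx] /=.
    rewrite xo setIid mul1r; field; rewrite total_cond_neq0 gt_eqF//.
  rewrite mul0r !mulr0 (_ : _ `&` _ = set0) ?pr0//.
  by apply/seteqP; split => // w [/= ->] /eqP; rewrite eq_sym (negbTE yx).
have [mU EU] := pr_sum_disjoint P uK
  (fun y => @measurable_last_exit n (fun=> A) y aA) (@last_exit_disjoint n (fun=> A)).
have AE : pr A = \sum_(y <- K) pr A / h x * (green N o x y * (c y * h y * nv y)).
  transitivity (pr [set w | exists2 y, y \in K & last_exit n (fun=> A) y w]).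
    apply: (eq_pr_ae _ _ negligible_recurrent_paths) => //.
      exact: measurable_at chainZ _ _.
    move=> w Gw; split=> [Aw|[y _ [k _ [[]]]]//].
    have [|k [Zk Nk]] := last_exit_exists Gw (n := n); first by rewrite Aw.
    by exists (Z (n + k)%N w) => //; exists k.
  rewrite EU big_seq [RHS]big_seq; apply: eq_bigr => y yK.
  rewrite (pr_last_exit (l := c y * h y * (pr A / h x * green N o x y)) yK aA).
    by ring.
  rewrite (_ : series _ = fun m => c y * h y * (pr A / h x * series (fun k => kk k x y) m)).
    by do 2 apply: cvgMr; exact: cvg_green alive_cvg0 _ _.
  by apply/funext => m; rewrite /series /= !mulr_sumr; apply: eq_bigr.
move: AE; rewrite -mulr_sumr => /eqP; rewrite -mulrA -subr_eq0 -{1}[pr A]mulr1 -mulrBr.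
rewrite mulf_eq0 gt_eqF//= subr_eq0 => /eqP /(congr1 ( *%R (h x))).
by rewrite mulr1 mulrA divff ?mul1r ?gt_eqF.
Qed.

End LastExit.

End HProcess.

(** * Crossings *)

Section Crossings.
Context {R : realType}.
Implicit Types (a b : R) (u : R^nat).

(* The first [n + 1] terms of [u] contain an alternating sequence of [m] terms,
   the first one [>= b], the second one [<= a], and so on. *)
Fixpoint crosses a b u (m n : nat) : Prop :=
  if m is m'.+1 then
    exists i, [/\ (i <= n)%N, crosses a b u m' i
                & if odd m' then u i <= a else b <= u i]
  else True.

Lemma crosses_mono a b u m i n :
  (i <= n)%N -> crosses a b u m i -> crosses a b u m n.
Proof.
case: m => //= m ni [j [ji cj uj]]; exists j; split => //; exact: leq_trans ni.
Qed.

Lemma crosses_le a b u m n : crosses a b u m.+1 n -> crosses a b u m n.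
Proof. by move=> /= [i [ni ci _]]; exact: crosses_mono ci. Qed.

Lemma crosses_ext a b u v m n : (forall i, (i <= n)%N -> u i = v i) ->
  crosses a b u m n -> crosses a b v m n.
Proof.
elim: m n => //= m IH n uv [i [ni ci ui]]; exists i; split => //.
  by apply: IH ci => j ji; apply: uv; exact: leq_trans ni.
by rewrite -uv.
Qed.

(** Where nothing can be recorded, a completed crossing was complete one step before; this drives
    the induction on time in the bound on visits. *)
Lemma crosses_last a b u m n : crosses a b u m.+1 n ->
  ~~ (if odd m then u n <= a else b <= u n) ->
  exists2 n', n = n'.+1 & crosses a b u m.+1 n'.
Proof.
move=> /= [i [ni ci ui]] un; move: ni; rewrite leq_eqVlt => /orP[/eqP E|].
  by move: un; rewrite -E ui.
by case: n un => // n un ni; exists n => //; exists i.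
Qed.

Lemma crosses_oscillation a b u :
  (forall n, exists2 i, (n <= i)%N & u i <= a) ->
  (forall n, exists2 i, (n <= i)%N & b <= u i) ->
  forall m, exists n, crosses a b u m n.
Proof.
move=> ua ub; elim=> [|m [n cn]]; first by exists 0%N.
have [i ni ui] : exists2 i, (n <= i)%N & if odd m then u i <= a else b <= u i.
  by case: (odd m).
exists i; exists i; split => //; exact: crosses_mono cn.
Qed.

(** If the lower and upper limits differ, there are rational levels strictly between them. Since [u]
    is nonnegative, the lower level is then positive, as the geometric bound in [a / b] requires. *)
Lemma bounded_nonosc_cvg u M : (forall n, 0 <= u n <= M) ->
  (forall a b : rat, 0 < ratr a :> R -> a < b ->
     ~ forall m, exists n, crosses (ratr a) (ratr b) u m n) ->
  cvgn u.
Proof.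
move=> u0M nosc.
have ubu : has_ubound (range u).
  by exists M => _ [n _ <-]; have /andP[] := u0M n.
have lbu : has_lbound (range u).
  by exists 0 => _ [n _ <-]; have /andP[] := u0M n.
have Cs := cvg_sups_inf ubu lbu; have Ci := cvg_infs_sup ubu lbu.
set s := inf (range (sups u)) in Cs; set i := sup (range (infs u)) in Ci.
have infs_le n : infs u n <= u n.
  by apply: ge_inf; [exact: has_lbound_sdrop|exists n => /=].
have sups_ge n : u n <= sups u n.
  by apply: ub_le_sup; [exact: has_ubound_sdrop|exists n => /=].
have le_is : i <= s.
  rewrite -(cvg_lim (@Rhausdorff R) Cs) -(cvg_lim (@Rhausdorff R) Ci).
  apply: ler_lim; [by apply/cvg_ex; exists i|by apply/cvg_ex; exists s|].
  by near=> n; exact: le_trans (infs_le n) (sups_ge n).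
have [lt_is|le_si] := ltP i s; last first.
  have Es : s = i by apply/eqP; rewrite eq_le le_si.
  apply/cvg_ex; exists i; apply: (squeeze_cvgr _ Ci); last by rewrite -Es; exact: Cs.
  by near=> n; rewrite infs_le sups_ge.
have [a] := rat_in_itvoo lt_is; rewrite in_itv /= => /andP[ia as_].
have [b] := rat_in_itvoo as_; rewrite in_itv /= => /andP[ab bs].
have infs_i n : infs u n <= i.
  apply: ub_le_sup; last by exists n.
  exists M => _ [m _ <-]; apply: le_trans (infs_le m) _.
  by have /andP[] := u0M m.
have sups_s n : s <= sups u n.
  apply: ge_inf; last by exists n.
  exists 0 => _ [m _ <-]; apply: le_trans (sups_ge m).
  by have /andP[] := u0M m.
exfalso; apply: (nosc a b).
- apply: le_lt_trans ia; apply: le_trans (infs_i 0%N).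
  apply: lb_le_inf; first by exists (u 0%N); exists 0%N.
  by move=> _ [m _ <-]; have /andP[] := u0M m.
- by rewrite -(ltr_rat R).
apply: crosses_oscillation => n.
  have [||_ [m /= nm <-] um] := @inf_lt _ (sdrop u n) (ratr a).
  - by exists (u n); exists n => /=.
  - exact: le_lt_trans (infs_i n) ia.
  - by exists m => //; exact: ltW.
have [||_ [m /= nm <-] um] := @sup_gt _ (sdrop u n) (ratr b).
- by exists (u n); exists n => /=.
- exact: lt_le_trans bs (sups_s n).
- by exists m => //; exact: ltW.
Unshelve. all: by end_near. Qed.

End Crossings.

Lemma vertex_enumeration {R : realType} {V : choiceType} (N : network R V) (o : V) :
  exists e : nat -> V, forall v, exists n, e n = v.
Proof.
have [f finj] := countable_injP _ (countable_vertices N).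
exists (fun n => xget o [set v | f v = n]) => v; exists (f v).
apply: finj; rewrite ?in_setT//.
by apply: (@xgetPex _ o [set u | f u = f v]); exists v.
Qed.

Lemma vertex_exhaustion {R : realType} {V : choiceType} (N : network R V) (o : V) :
  exists K : nat -> seq V, (forall i, uniq (K i)) /\
    forall v, exists i0, forall i, (i0 <= i)%N -> v \in K i.
Proof.
have [e esurj] := vertex_enumeration N o.
exists (fun i => undup (mkseq e i)); split=> [i|v]; first exact: undup_uniq.
have [n <-] := esurj v; exists n.+1 => i ni; rewrite mem_undup.
by apply/mapP; exists n => //; rewrite mem_iota.
Qed.

(** * Crossings along the h-process *)

Section HProcessCrossings.
Context {R : realType} {V : choiceType} (N : network R V) (o : V) (h : V -> R).
Context {d : measure_display} {T : measurableType d}.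
Variables (P : probability T R) (Z : nat -> T -> V).

Local Notation c := (total_cond N).
Local Notation Q := (iter_killed N o).
Local Notation r := (exit_prob N o).
Local Notation q := (doob_trans N h).
Local Notation pr := (rprob P).
Local Notation adapted := (adapted Z).

Hypothesis alive_cvg0 : forall y, Q n (alive o) y @[n --> \oo] --> (0 : R).
Hypothesis pot_h : potential N o h.
Hypothesis chainZ : markov_chain P (fun v => cond N o v * h v) q Z.

Variables (f : V -> R) (a b : R).
Hypotheses (f_ge0 : forall y, 0 <= f y) (fo : f o = 0).
Hypothesis f_super : forall y, killed N o f y <= f y.
Hypotheses (a_gt0 : 0 < a) (ab : a < b).

Let q_nonadj := @doob_trans_nonadj _ _ N h.
Let adm n A := @adapted_measurable _ _ N _ _ _ _ _ _ chainZ n A.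
Let b_gt0 : 0 < b := lt_trans a_gt0 ab.

Definition crossing m n : set T := [set w | crosses a b (fun i => f (Z i w)) m n].

Lemma adapted_crossing m n : adapted n (crossing m n).
Proof. by move=> w w' E; apply: crosses_ext => i ni; rewrite E. Qed.

Let measurable_crossing_at m n i y : (n <= i)%N ->
  measurable (crossing m n `&` [set w | Z i w = y]).
Proof.
move=> ni; apply: measurableI; first exact: adm (@adapted_crossing m n).
exact: measurable_at chainZ _ _.
Qed.

(** An expected number of visits, truncated at time [k] to permit induction on [k]. As a function of
    [y] it is a measure, to be compared with [c * h]. *)
Definition crossing_visits m k y : R :=
  \sum_(n < k) pr (crossing m n `&` [set w | Z n w = y]).
Local Notation S := crossing_visits.

Lemma crossing_visits_le m k y : S m.+1 k y <= S m k y.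
Proof.
apply: ler_sum => n _; apply: le_pr; do ?exact: measurable_crossing_at.
by move=> w [/crosses_le].
Qed.

(* A maximum principle for the reversed walk: outside the set of [y] where the
   next crossing is recorded, [S m.+1 _ y / (c y * h y)] is subharmonic. *)
Lemma crossing_visits_bound m (g : V -> R) : g o = 0 -> (forall y, 0 <= g y) ->
  (forall y, killed N o g y <= g y) ->
  (forall y k, (if odd m then f y <= a else b <= f y) ->
     S m.+1 k y <= c y * h y * g y) ->
  forall k y, S m.+1 k y <= c y * h y * g y.
Proof.
move=> go g0 gs bnd; elim=> [|k IH] y.
  rewrite /S big_ord0 mulr_ge0// mulr_ge0 ?(potential_ge0 pot_h)//.
  by rewrite ltW ?total_cond_gt0.
have [/bnd //|ncond] := boolP (if odd m then f y <= a else b <= f y).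
rewrite /S big_ord_recl /=.
have -> : crossing m.+1 0 `&` [set w | Z 0%N w = y] = set0.
  apply/seteqP; split => // w [cw /= Zw].
  by have [|//] := crosses_last cw; rewrite Zw.
rewrite pr0 add0r.
apply: (@le_trans _ _ (\sum_(x <- nb N y) S m.+1 k x * q x y)).
  rewrite /S; under [leRHS]eq_bigr do rewrite mulr_suml.
  rewrite exchange_big /=; apply: ler_sum => n _.
  rewrite -(adapted_next chainZ q_nonadj); last exact: adapted_crossing.
  apply: le_pr; do ?by apply: measurable_crossing_at.
  move=> w [cw /= Zw]; split => //.
  by have [|n' [<-]//] := crosses_last cw; rewrite Zw.
apply: le_trans (doob_reversal_le pot_h y go IH) _.
apply: ler_wpM2l => //; rewrite mulr_ge0 ?(potential_ge0 pot_h)//.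
by rewrite ltW ?total_cond_gt0.
Qed.

(** Where an odd crossing is recorded, [f >= b], so the previous constant bound may be multiplied by
    [f / b]; where the next one is recorded, [f <= a] and this factor is at most [a / b].
    Superharmonicity extends each bound to all of [V]. *)
Lemma crossing_visits_geom j k y :
  S j.*2 k y <= c y * h y * (a / b) ^+ j.
Proof.
have ch0 z : 0 <= c z * h z.
  by rewrite mulr_ge0 ?(potential_ge0 pot_h)// ltW ?total_cond_gt0.
have ab0 i : 0 <= (a / b) ^+ i by rewrite exprn_ge0// divr_ge0// ltW.
elim: j k y => [|j IH] k y.
  rewrite expr0 mulr1 /S; apply: (@le_trans _ _ (c y * h y * \sum_(n < k) Q n r y)).
    rewrite mulr_sumr; apply: ler_sum => n _.
    by rewrite (_ : _ `&` _ = [set w | Z n w = y]) ?(pr_doob pot_h chainZ) ?setTI.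
  by rewrite -[leRHS]mulr1 ler_wpM2l// sum_iter_exit_le1.
have odd_bound k' z : S j.*2.+1 k' z <= c z * h z * ((a / b) ^+ j / b * f z).
  move: k' z; apply: crossing_visits_bound.
  - by rewrite fo mulr0.
  - by move=> z; rewrite mulr_ge0// divr_ge0// ltW.
  - by move=> z; rewrite killedZ ler_wpM2l// divr_ge0// ltW.
  move=> z k'; rewrite odd_double => bf.
  apply: le_trans (crossing_visits_le _ _ _) _; apply: le_trans (IH _ _) _.
  apply: ler_wpM2l => //; rewrite -mulrA -[leLHS]mulr1; apply: ler_wpM2l => //.
  by rewrite mulrC ler_pdivlMr// mul1r.
(* [alive] takes the place of the constant 1, since the comparison function must vanish at [o]. *)
have even_bound : forall k' z,
    S j.*2.+2 k' z <= c z * h z * ((a / b) ^+ j.+1 * alive o z).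
  apply: crossing_visits_bound.
  - by rewrite aliveo mulr0.
  - by move=> z; rewrite mulr_ge0 ?alive_ge0.
  - by move=> z; rewrite killedZ ler_wpM2l// killed_alive_le.
  move=> z k'; rewrite /= odd_double /= => fa.
  apply: le_trans (crossing_visits_le _ _ _) _; apply: le_trans (odd_bound _ _) _.
  have [->|zo] := eqVneq z o; first by rewrite (potentialo pot_h) mulr0 !mul0r.
  apply: ler_wpM2l => //; rewrite /alive zo mulr1 exprSr -mulrA; apply: ler_wpM2l => //.
  by rewrite mulrC ler_wpM2r// invr_ge0 ltW.
rewrite doubleS; apply: le_trans (even_bound k y) _.
by apply: ler_wpM2l => //; rewrite ler_piMr// /alive lern1 leq_b1.
Qed.

(** The bound on visits has the same factor at each [y], and the weights [c * h * never_prob] have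
    total mass at most 1 for any [K]. *)
Lemma pr_last_exit_crossing (K : seq V) j : uniq K ->
  measurable [set w | exists2 y, y \in K & last_exit Z K 0 (crossing j.*2) y w] /\
  pr [set w | exists2 y, y \in K & last_exit Z K 0 (crossing j.*2) y w]
    <= (a / b) ^+ j.
Proof.
move=> uK.
have aE k : adapted (0 + k)%N (crossing j.*2 k) by exact: adapted_crossing.
have [mU ->] := pr_sum_disjoint P uK
  (fun y => @measurable_last_exit _ _ N _ _ _ _ _ _ chainZ K 0 (crossing j.*2) y aE)
  (@last_exit_disjoint _ _ _ Z K 0 (crossing j.*2)).
split => //; have ab0 : 0 <= (a / b) ^+ j by rewrite exprn_ge0// divr_ge0// ltW.
apply: (@le_trans _ _ (\sum_(y <- K) (a / b) ^+ j * (c y * h y * never_prob N q K y))).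
  rewrite big_seq [leRHS]big_seq; apply: ler_sum => y yK.
  set u := series (fun k => pr (crossing j.*2 k `&` [set w | Z (0 + k)%N w = y])).
  have uE k : u k = S j.*2 k y by rewrite /u /series /= big_mkord.
  have Cu : cvgn u.
    apply: nondecreasing_is_cvgn.
      by apply/nondecreasing_seqP => k; rewrite /u seriesSr lerDl pr_ge0.
    exists (c y * h y * (a / b) ^+ j) => _ [k _ <-].
    by rewrite uE crossing_visits_geom.
  rewrite (pr_last_exit pot_h chainZ yK aE Cu) mulrA.
  apply: ler_wpM2r; first exact: never_prob_ge0 (doob_trans_ge0 pot_h) (sum_doob_trans_le1 pot_h) _ _.
  rewrite mulrC; apply: limr_le => //; near=> k.
  by rewrite uE crossing_visits_geom.
rewrite -mulr_sumr -[leRHS]mulr1; apply: ler_wpM2l => //.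
exact: sum_never_prob_le1 alive_cvg0 pot_h chainZ _ uK.
Unshelve. all: by end_near. Qed.

Lemma pr_crossing_le j : pr (\bigcup_n crossing j.*2 n) <= (a / b) ^+ j.
Proof.
have [K [uK Kinc]] := vertex_exhaustion N o.
pose F i := [set w | exists2 y, y \in K i & last_exit Z (K i) 0 (crossing j.*2) y w].
have mF i : measurable (F i) by have [] := @pr_last_exit_crossing (K i) j (uK i).
apply: (pr_eventually_le (F := F) mF _ (negligible_recurrent_paths alive_cvg0 pot_h chainZ)).
- by apply: bigcupT_measurable => n; exact: adm (@adapted_crossing _ n).
- by move=> i; have [] := @pr_last_exit_crossing (K i) j (uK i).
(* Once [K i] contains [Z n w], the last exit comes no earlier than [n], hence after the
   crossings. *)
move=> w Gw [n _ cn]; have [i0 Hi0] := Kinc (Z n w).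
exists i0 => // i /= ii0; have Zi := Hi0 i ii0.
have [k [Zk Nk]] := last_exit_exists Gw Zi.
exists (Z (n + k)%N w) => //; exists (n + k)%N => //; split => //; split => //.
exact: crosses_mono (leq_addr _ _) cn.
Qed.

Lemma negligible_crossings :
  P.-negligible [set w | forall m, exists n, crosses a b (fun i => f (Z i w)) m n].
Proof.
have mA j : measurable (\bigcup_n crossing j.*2 n).
  by apply: bigcupT_measurable => n; exact: adm (@adapted_crossing _ n).
exists (\bigcap_j \bigcup_n crossing j.*2 n).
have mI : measurable (\bigcap_j \bigcup_n crossing j.*2 n).
  exact: bigcapT_measurable.
split => //; last by move=> w cw j _; have [n] := cw j.*2; exists n.
suff p0 : pr (\bigcap_j \bigcup_n crossing j.*2 n) <= 0.
  by rewrite (prE P mI); congr EFin; apply/eqP; rewrite eq_le p0 pr_ge0.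
have ab1 : `|a / b| < 1.
  by rewrite ger0_norm ?divr_ge0 ?ltW// ltr_pdivrMr// mul1r.
have C := cvg_expr ab1.
rewrite -(cvg_lim (@Rhausdorff R) C); apply: limr_ge; first by apply/cvg_ex; exists 0.
near=> j; apply: le_trans (pr_crossing_le j); apply: le_pr => //.
by move=> w; apply.
Unshelve. all: by end_near.
Qed.

End HProcessCrossings.

(** * Random potentials *)

Section RandomPotential.
Context {R : realType} {V : choiceType} (N : network R V) (o : V).
Context {d : measure_display} {T : measurableType d} (P : probability T R).
Variable H : V -> T -> R.
Hypothesis mH : forall v, measurable_fun setT (H v).
Hypothesis bH : forall v, exists M, forall w, H v w <= M.
Hypothesis pH : forall w, potential N o (fun v => H v w).
Local Notation pr := (rprob P).

Lemma integrable_potential v A : measurable A -> P.-integrable A (EFin \o H v).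
Proof.
move=> mA; have [M HM] := bH v.
apply: measurable_bounded_integrable => //.
- by rewrite (le_lt_trans (probability_le1 P mA))// ltry.
- exact: measurable_funS (mH v).
exists `|M|; split; first exact: num_real.
move=> x xM w _ /=; have Hw := potential_ge0 (pH w) v.
rewrite ger0_norm//; apply: le_trans (HM w) _.
by apply: le_trans (ler_norm M) _; exact: ltW.
Qed.

Lemma Rintegral_sum_potential (a : V -> R) (s : seq V) A : measurable A ->
  \int[P]_(w in A) (\sum_(x <- s) a x * H x w)
  = \sum_(x <- s) a x * \int[P]_(w in A) H x w.
Proof.
move=> mA.
have int_s t : P.-integrable A (EFin \o (fun w => \sum_(x <- t) a x * H x w)).
  elim: t => [|x t IH].
    rewrite (_ : _ \o _ = cst 0%E); first exact: integrable0.
    by apply/funext => w /=; rewrite big_nil.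
  rewrite (_ : _ \o _ = (fun w => (a x)%:E * (EFin \o H x) w
      + (EFin \o (fun w => \sum_(x <- t) a x * H x w)%R) w)%E).
    apply: integrableD => //; apply: integrableZl => //; exact: integrable_potential.
  by apply/funext => w /=; rewrite big_cons EFinD EFinM.
elim: s => [|x s IH].
  rewrite big_nil (_ : (fun w => _) = cst 0) ?Rintegral_cst ?mul0r//.
  by apply/funext => w; rewrite big_nil.
rewrite big_cons -IH -RintegralZl//; last exact: integrable_potential.
rewrite -RintegralD//; last first.
  rewrite (_ : _ \o _ = (fun w => (a x)%:E * (EFin \o H x) w)%E).
    by apply: integrableZl => //; exact: integrable_potential.
  by apply/funext => w /=; rewrite EFinM.
by apply: eq_Rintegral => w _; rewrite big_cons.
Qed.

(** By local finiteness, the equations defining a potential are finite and linear, so they pass to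
    averages over [A]. *)
Lemma conditional_potential A : measurable A -> 0 < pr A ->
  potential N o (fun v => (pr A)^-1 * \int[P]_(w in A) H v w).
Proof.
move=> mA A0; apply/potentialP.
have lin (a : V -> R) s : \sum_(x <- s) a x * ((pr A)^-1 * \int[P]_(w in A) H x w)
    = (pr A)^-1 * \int[P]_(w in A) (\sum_(x <- s) a x * H x w).
  by rewrite Rintegral_sum_potential// mulr_sumr; apply: eq_bigr => x _; rewrite mulrCA.
split.
- move=> v; apply: mulr_ge0; first by rewrite invr_ge0 ltW.
  by apply: Rintegral_ge0 => w _; exact: potential_ge0 (pH w) v.
- rewrite (@eq_Rintegral _ _ _ _ _ (cst 0)) ?Rintegral_cst ?mul0r ?mulr0// => w _.
  exact: potentialo (pH w).
- rewrite lin (@eq_Rintegral _ _ _ _ _ (cst 1)) => [|w _].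
    by rewrite Rintegral_cst// mul1r mulVf// gt_eqF.
  by have /potentialP[] := pH w.
- move=> v vo; rewrite lin; congr (_ * _); apply: eq_Rintegral => w _.
  by have /potentialP[_ _ _ ->] := pH w.
Qed.

Lemma extremal_conditional (h : V -> R) A v : extremal_potential N o h ->
  (forall x, \int[P]_w H x w = h x) -> measurable A ->
  \int[P]_(w in A) H v w = h v * pr A.
Proof.
move=> [pot_h ext_h] EH mA.
have mCA : measurable (~` A) by exact: measurableC.
have pCA : pr (~` A) = 1 - pr A.
  have := prU P mA mCA (setICr A); rewrite setUv prT => ->; ring.
have null B x : measurable B -> pr B = 0 -> \int[P]_(w in B) H x w = 0.
  move=> mB B0; have PB0 : P B = 0%E by rewrite (prE P mB) B0.
  rewrite /Rintegral null_set_integral//.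
  exact: measurable_int (integrable_potential x mB).
have split_int x : \int[P]_(w in A) H x w + \int[P]_(w in ~` A) H x w = h x.
  rewrite -EH -Rintegral_setU//; first by rewrite setUv.
    by rewrite setUv; exact: integrable_potential.
  by rewrite disj_set2E setICr.
(* Extremality speaks of weights strictly between 0 and 1; events of probability 0 or 1 are treated
   apart. *)
have [A0|An0] := eqVneq (pr A) 0; first by rewrite A0 mulr0 null.
have [A1|An1] := eqVneq (pr A) 1.
  rewrite A1 mulr1 -(split_int v) [X in _ = _ + X]null ?addr0//.
  by rewrite pCA A1 subrr.
have A_gt0 : 0 < pr A by rewrite lt_neqAle eq_sym An0 pr_ge0.
have A_lt1 : pr A < 1 by rewrite lt_neqAle An1 pr_le1.
have CA_gt0 : 0 < pr (~` A) by rewrite pCA subr_gt0.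
have pot1 := conditional_potential mA A_gt0.
have pot2 := conditional_potential mCA CA_gt0.
have dec x : h x = pr A * ((pr A)^-1 * \int[P]_(w in A) H x w)
    + (1 - pr A) * ((pr (~` A))^-1 * \int[P]_(w in ~` A) H x w).
  by rewrite -pCA !mulVKf ?gt_eqF.
(* Extremality identifies the two conditional means; by [dec] their common value is [h]. *)
have /(congr1 (@^~ v)) /= E := ext_h _ _ _ pot1 pot2 A_gt0 A_lt1 dec.
have hv : h v = (pr A)^-1 * \int[P]_(w in A) H v w.
  by rewrite dec -E; ring.
by rewrite hv mulrAC mulVf// mul1r.
Qed.

Lemma extremal_ae_eq (h : V -> R) : extremal_potential N o h ->
  (forall x, \int[P]_w H x w = h x) ->
  {ae P, forall w, forall x, H x w = h x}.
Proof.
move=> ext_h EH; have [e esurj] := vertex_enumeration N o.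
apply: (@negligibleS _ _ _ P (\bigcup_n ~` [set w | H (e n) w = h (e n)])).
  move=> w /existsNP[x Hx]; have [n en] := esurj x; exists n => //=.
  by rewrite en.
apply: negligible_bigcup => n; set x := e n.
have := @integral_ae_eq _ _ _ P setT measurableT (cst (h x)%:E) (EFin \o H x)
  (integrable_potential x measurableT) (measurable_cst _).
case.
  move=> A _ mA; rewrite integral_cst//.
  transitivity ((h x)%:E * (pr A)%:E)%E; last by rewrite -(prE P mA).
  rewrite -EFinM -(extremal_conditional x ext_h EH mA).
  by rewrite /Rintegral fineK// integrable_fin_num//; exact: integrable_potential.
move=> B [mB B0 sB]; exists B; split => // w Hw; apply: sB => /= /(_ Logic.I) E.
by apply: Hw; apply: EFin_inj.
Qed.

End RandomPotential.

(** * Limits of Green functions along the h-process *)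

Section GreenLimit.
Context {R : realType} {V : choiceType} (N : network R V) (o : V) (h : V -> R).
Context {d : measure_display} {T : measurableType d}.
Variables (P : probability T R) (Z : nat -> T -> V).

Local Notation c := (total_cond N).
Local Notation Q := (iter_killed N o).
Local Notation q := (doob_trans N h).
Local Notation pr := (rprob P).
Local Notation g := (green N o).

Hypothesis alive_cvg0 : forall y, Q n (alive o) y @[n --> \oo] --> (0 : R).
Hypothesis pot_h : potential N o h.
Hypothesis chainZ : markov_chain P (fun v => cond N o v * h v) q Z.
Hypothesis Zpos : forall n w, 0 < h (Z n w).

Let Zo n w : Z n w != o.
Proof. by apply: contraTneq (Zpos n w) => ->; rewrite (potentialo pot_h) ltxx. Qed.

Definition convergent_paths : set T :=
  [set w | forall x, cvgn (fun n => g x (Z n w))].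

Lemma negligible_divergent_paths : P.-negligible (~` convergent_paths).
Proof.
have [e esurj] := vertex_enumeration N o.
(* A vertex and two rational levels: countably many ways to diverge. *)
pose bad (i : nat * (rat * rat)) : set T :=
  [set w | [/\ 0 < ratr i.2.1 :> R, i.2.1 < i.2.2 & forall m, exists n,
    crosses (ratr i.2.1) (ratr i.2.2 : R) (fun n => g (e i.1) (Z n w)) m n]].
apply: (@negligibleS _ _ _ P
    (\bigcup_k (if choice.unpickle k is Some i then bad i else set0))).
  move=> w /existsNP[x ndiv]; apply: contrapT => nbad; apply: ndiv.
  have [M M0 gM] := green_le alive_cvg0 x.
  apply: (bounded_nonosc_cvg (M := M)).
    by move=> n; rewrite green_ge0//= gM.
  move=> a b a0 ab osc; apply: nbad; have [n en] := esurj x.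
  exists (choice.pickle (n, (a, b))) => //; rewrite choice.pickleK.
  by split => //=; rewrite en.
apply: negligible_bigcup => k; case: choice.unpickle => [[n [a b]]|]; last first.
  exact: negligible_set0.
have [a0|na] := boolP (0 < ratr a :> R); last first.
  by apply: (@negligibleS _ _ _ P set0); [move=> w []; rewrite (negbTE na)|
    exact: negligible_set0].
have [ab|nab] := boolP (a < b); last first.
  by apply: (@negligibleS _ _ _ P set0); [move=> w [_]; rewrite (negbTE nab)|
    exact: negligible_set0].
apply: (@negligibleS _ _ _ P) (negligible_crossings alive_cvg0 pot_h chainZ
  (f := g (e n)) (a := ratr a) (b := ratr b) _ _ _ _ _).
- by move=> w [].
- by move=> y; exact: green_ge0.
- exact: greeno.
- by move=> y; exact: killed_green_le.
- by [].
- by rewrite ltr_rat.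
Qed.

Lemma green_limit_potential w : transient_paths Z w -> convergent_paths w ->
  potential N o (fun x => limn (fun n => g x (Z n w))).
Proof.
move=> Tw Cw; apply/potentialP; split.
- by move=> x; apply: limr_ge; [exact: Cw|near=> n; exact: green_ge0].
- rewrite (_ : (fun n => _) = fun=> 0) ?lim_cst//.
  by apply/funext => n; rewrite greenol.
- apply: (cvgn_unique (cvg_sum_seq (a := cond N o) (fun z (_ : z \in nb N o) => Cw z))).
  rewrite (_ : (fun n => _) = fun=> 1); first exact: cvg_cst.
  by apply/funext => n; rewrite (sum_cond_green alive_cvg0) /alive Zo.
move=> v vo.
have C := cvg_sum_seq (a := walk_trans N v) (fun z (_ : z \in nb N v) => Cw z).
have [n0 Hn0] := Tw [:: v].
apply: (cvgn_unique C); apply: cvg_trans (Cw v); apply: near_eq_cvg.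
near=> n; rewrite green_harmonicl//.
have : (n0 <= n)%N by near: n; exists n0.
by move=> /Hn0; rewrite inE.
Unshelve. all: by end_near. Qed.

(** The value of [g_o(x, .)] at the last exit from [K], and 0 if there is none; as a finite sum of
    indicators it is measurable and easy to integrate. *)
Definition last_exit_green (K : seq V) (x : V) (w : T) : R :=
  \sum_(y <- K) g x y * \1_(last_exit Z K 0 (fun=> setT) y) w.

Let mLE K y : measurable (last_exit Z K 0 (fun=> setT) y).
Proof.
exact: (@measurable_last_exit _ _ N _ _ _ _ _ _ chainZ K 0 (fun=> setT) y
  (fun k => @adaptedT _ _ _ Z _)).
Qed.

Lemma measurable_last_exit_green K x : measurable_fun setT (last_exit_green K x).
Proof.
apply: measurable_sum => y; apply: measurable_funM; first exact: measurable_cst.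
exact: measurable_indic.
Qed.

Lemma last_exit_greenE K x w k : uniq K -> Z k w \in K -> never_after Z K k w ->
  last_exit_green K x w = g x (Z k w).
Proof.
move=> uK Zk Nk; rewrite /last_exit_green (bigD1_seq (Z k w))//= indicE mem_set.
  rewrite mulr1 big_seq_cond big1 ?addr0// => y /andP[yK yZ].
  rewrite indicE memNset ?mulr0// => -[j _ [[_ /= Zj] Nj]].
  move/eqP: yZ; apply; rewrite -Zj; congr (Z _ w).
  by apply: last_exit_time_unique Nj Nk; rewrite ?Zj.
by exists k.
Qed.

Lemma last_exit_green_bound K x M w : uniq K -> 0 <= M ->
  (forall y, g x y <= M) -> 0 <= last_exit_green K x w <= M.
Proof.
move=> uK M0 gM.
have [[k [Zk Nk]]|no] := pselect (exists k, Z k w \in K /\ never_after Z K k w).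
  by rewrite (last_exit_greenE x uK Zk Nk) green_ge0//= gM.
rewrite /last_exit_green big_seq big1 ?lexx// => y yK.
rewrite indicE memNset ?mulr0// => -[j _ [[_ /= Zj] Nj]].
by apply: no; exists j; rewrite Zj.
Qed.

Lemma integral_last_exit_green K x : uniq K -> x \in K -> 0 < h x ->
  (\int[P]_w (last_exit_green K x w)%:E = (h x)%:E)%E.
Proof.
move=> uK xK hx; rewrite /last_exit_green.
under eq_integral do rewrite -sumEFin.
rewrite ge0_integral_sum//; last 2 first.
- move=> y; apply/measurable_EFinP; apply: measurable_funM; first exact: measurable_cst.
  exact: measurable_indic.
- by move=> y w _; rewrite lee_fin mulr_ge0// green_ge0.
rewrite -(green_last_exit alive_cvg0 pot_h chainZ uK xK hx) -sumEFin.
rewrite big_seq [RHS]big_seq; apply: eq_bigr => y yK.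
under eq_integral do rewrite EFinM.
rewrite ge0_integralZl//; last 2 first.
- by apply/measurable_EFinP; exact: measurable_indic.
- by rewrite lee_fin green_ge0.
rewrite integral_indic// setIT.
transitivity ((g x y)%:E * (pr (last_exit Z K 0 (fun=> setT) y))%:E)%E.
  by rewrite -(prE P (mLE K y)).
by rewrite -EFinM (pr_last_exitT alive_cvg0 pot_h chainZ).
Qed.

Lemma cvg_last_exit_green (K : nat -> seq V) x w :
  (forall i, uniq (K i)) ->
  (forall v, exists i0, forall i, (i0 <= i)%N -> v \in K i) ->
  transient_paths Z w -> convergent_paths w ->
  last_exit_green (K i) x w @[i --> \oo] --> limn (fun n => g x (Z n w)).
Proof.
move=> uK Kinc Tw Cw; apply/cvgrPdist_lt => eps eps0.
have /cvgrPdist_lt/(_ eps eps0)[n0 _ Hn0] := Cw x.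
(* The last exit from a set containing [Z n0 w] is at a time at least [n0], so last exit times tend
   to infinity. *)
have [i0 Hi0] := Kinc (Z n0 w); exists i0 => // i /= /Hi0 Zi.
have [k [Zk Nk]] := last_exit_exists Tw Zi.
by rewrite (last_exit_greenE x (uK i) Zk Nk); apply: Hn0 => /=; exact: leq_addr.
Qed.

Lemma expectation_green_limit (H : V -> T -> R) x :
  (forall v, measurable_fun setT (H v)) ->
  {ae P, forall w, [/\ transient_paths Z w, convergent_paths w
                     & H x w = limn (fun n => g x (Z n w))]} ->
  0 < h x -> (\int[P]_w (H x w)%:E = (h x)%:E)%E.
Proof.
move=> mH aeH hx; have [K [uK Kinc]] := vertex_exhaustion N o.
have [M M0 gM] := green_le alive_cvg0 x.
have := @dominated_convergence _ T R P setT measurableT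
  (fun i w => (last_exit_green (K i) x w)%:E) (fun w => (H x w)%:E) (cst M%:E)
  (fun i => measurableT_comp (@EFin_measurable _ _) (measurable_last_exit_green (K i) x))
  (measurableT_comp (@EFin_measurable _ _) (mH x)).
case.
- apply: filterS aeH => w [Tw Cw Hw] _; rewrite Hw.
  apply: cvg_EFin; first by near=> i.
  exact: cvg_last_exit_green.
- exact: finite_measure_integrable_cst.
- apply: aeW => w i _; rewrite abse_EFin lee_fin.
  have /andP[l0 lM] := last_exit_green_bound w (uK i) M0 gM.
  by rewrite ger0_norm.
(* The integrals equal [h x] as soon as [K i] contains [x]. *)
move=> _ _ C; have [i0 Hi0] := Kinc x.
rewrite -(cvg_lim (@ereal_hausdorff R) C); apply: lim_near_cst => //.
near=> i; apply: integral_last_exit_green => //; apply: Hi0.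
by near: i; exists i0.
Unshelve. all: by end_near. Qed.

End GreenLimit.

Theorem theorem5p1 (R : realType) (V : choiceType) (N : network R V) (o : V)
  (dW : measure_display) (W : measurableType dW)
  (PW : V -> probability W R) (X : nat -> W -> V)
  (walkX : network_walk N PW X) (recX : recurrent_walk PW X)
  (h : V -> R) (pot_h : potential N o h)
  (d : measure_display) (T : measurableType d) (P : probability T R)
  (Y : nat -> T -> hstates h)
  (chainY : markov_chain P (hinit N o h) (htrans N h) Y) :
  exists H : V -> {RV P >-> R},
    [/\ forall w, potential N o (fun x => H x w),
        {ae P, forall w, forall x : V,
          green_density N PW X o x (val (Y n w)) @[n --> \oo]
            --> (H x w)%:E},
        forall x, 'E_P[H x]%E = (h x)%:E
      & extremal_potential N o h -> {ae P, forall w, forall x, H x w = h x}].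
Proof.
pose Z n w := val (Y n w).
have alive0 y : iter_killed N o n (alive o) y @[n --> \oo] --> (0 : R).
  exact: cvg_iter_alive walkX recX _.
have chainZ : markov_chain P _ _ Z := val_doob_chain pot_h chainY.
have Zpos n w : 0 < h (Z n w) by have := set_valP (Y n w).
have Zo n w : Z n w != o.
  by apply: contraTneq (Zpos n w) => ->; rewrite (potentialo pot_h) ltxx.
pose g := green N o.
have : P.-negligible (~` (transient_paths Z `&` convergent_paths N o Z)).
  rewrite setCI; apply: negligibleU.
    exact: negligible_recurrent_paths alive0 pot_h chainZ.
  exact: negligible_divergent_paths alive0 pot_h chainZ.
move=> [B [mB B0 GB]].
have good w : w \notin B -> transient_paths Z w /\ convergent_paths N o Z w.
  by move=> wB; apply: contrapT => nG; move/negP: wB; apply; exact/mem_set/GB.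
(* The value [h] on the null set [B] makes every realization, and not only almost every one, a
   potential. *)
pose H0 x w := if w \in B then h x else limn (fun n => g x (Z n w)).
have mH x : measurable_fun setT (H0 x).
  apply: (@measurable_fun_cvg _ _ _ setT
    (fun n w => h x * \1_B w + g x (Z n w) * \1_(~` B) w)) => [n|w _].
    apply: measurable_funD; apply: measurable_funM;
      do ?[exact: measurable_cst|exact: measurable_indic|
           apply: measurable_indic; exact: measurableC].
    move=> _ S mS; rewrite setTI.
    exact: (measurable_chain chainZ n (g x @^-1` S)).
  rewrite /H0 !indicE in_setC; have [wB|/good[_ Cw]] /= := boolP (w \in B).
    by rewrite mulr1; under eq_fun do rewrite mulr0 addr0; exact: cvg_cst.
  by rewrite mulr0; under eq_fun do rewrite mulr1 add0r; exact: Cw.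
have pH w : potential N o (H0^~ w).
  rewrite /H0; have [//|/good[Tw Cw]] := boolP (w \in B).
  have /= := green_limit_potential alive0 pot_h Zpos Tw Cw; exact.
have bH x : exists M, forall w, H0 x w <= M.
  have [M M0 gM] := green_le alive0 x.
  exists (h x + M) => w; rewrite /H0; case: ifPn => [_|/good[_ Cw]].
    by rewrite lerDl.
  rewrite (@le_trans _ _ M) ?lerDr ?(potential_ge0 pot_h)//.
  by apply: limr_le; [exact: Cw|near=> n; exact: gM].
have EH x : (\int[P]_w (H0 x w)%:E = (h x)%:E)%E.
  have [hx|hx] := ltP 0 (h x).
    apply: (expectation_green_limit alive0 pot_h chainZ) => //.
    exists B; split => // w nG; apply: contrapT => wB; apply: nG.
    have wB' : w \notin B by apply/negP => /set_mem.
    by have [Tw Cw] := good w wB'; split; rewrite ?/H0 ?(negbTE wB').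
  (* Here [g_o(x, Z n w)] vanishes for all [n], since the chain stays in the support of [h]. *)
  have hx0 : h x = 0 by apply/eqP; rewrite eq_le hx (potential_ge0 pot_h).
  rewrite hx0 (eq_integral (cst 0%E)) ?integral0// => w _; rewrite /H0 hx0.
  case: ifPn => // wB; rewrite (_ : (fun n => _) = fun=> 0) ?lim_cst//.
  by apply/funext => n; rewrite /g (green_potential0 pot_h hx0 (Zpos n w)).
exists (fun x => mfun_Sub (mem_set (mH x))); split => //=.
- exists B; split => // w /existsNP[x ncvg]; apply: contrapT => wB; apply: ncvg.
  have wB' : w \notin B by apply/negP => /set_mem.
  have [_ Cw] := good w wB'.
  rewrite /H0 (negbTE wB').
  rewrite (_ : (fun n => _) = EFin \o (fun n => g x (Z n w))).
    by apply: cvg_EFin; [near=> n|exact: Cw].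
  by apply/funext => n /=; rewrite (green_densityE walkX recX x (Zo n w)).
- by move=> x; rewrite unlock EH.
- move=> ext_h; apply: (@extremal_ae_eq _ _ _ _ _ _ P H0 mH bH pH h ext_h) => x.
  by rewrite /Rintegral EH.
Unshelve. all: by end_near. Qed.
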